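(* Let $\beta$ be a positive distribution on $\{0,1\}$ (i.e. $\beta(0),\beta(1)>0$, $\beta(0)+\beta(1)=1$), let $X\subseteq\mathbf{C}$, and let $g:\{0,1\}^*\to\{0,1\}^*$. If $\dim^g_{\mathrm{p}}(X)=0$, then $\dim^g_{\mathrm{p},\beta}(X)<1$.
   Context: $\mathbf{C}$ is the set of all languages $A\subseteq\{0,1\}^*$, each identified with its characteristic sequence over $\{0,1\}$ with respect to the length-lexicographic enumeration $s_0,s_1,\dots$ of $\{0,1\}^*$ ($n$-th bit is $1$ iff $s_n\in A$). $\mathrm{p}^g$ is the class of functions computable in polynomial time by an oracle machine with oracle access to the function $g$. For a distribution $\beta$ on $\{0,1\}$ and $s\ge0$, a $\beta$-$s$-gale is $d:\{0,1\}^*\to[0,\infty)$ with $d(w)=d(w0)\beta(0)^s+d(w1)\beta(1)^s$; it succeeds on $A$ if $\limsup_n d(A\upharpoonright n)=\infty$. $d$ is $\mathrm{p}^g$-computable if some $\hat d\in\mathrm{p}^g$ satisfies $|\hat d(w,r)-d(w)|\le 2^{-r}$ (rational output, $r$ in unary). $\dim^g_{\mathrm{p},\beta}(X)$ is the infimum of $s$ such that some $\mathrm{p}^g$-computable $\beta$-$s$-gale succeeds on every $A\in X$; $\dim^g_{\mathrm{p}}(X)$ is this with $\beta$ uniform (so $\beta$-$s$-gales are ordinary $s$-gales $d(w)=2^{-s}[d(w0)+d(w1)]$).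
   Formalization: The formal statement additionally assumes that β(0) and β(1) are p^g-computable reals; without this the claim is false, since for any other β some single language has dim^g_p equal to 0 but no p^g-computable β-s-gale with s<1 succeeds on it. *)

(* Defs.v *)
From HB Require Import structures.
From mathcomp Require Import all_boot all_order all_algebra.
From mathcomp Require Import all_classical all_reals all_analysis.

Set Implicit Arguments.
Unset Strict Implicit.
Unset Printing Implicit Defensive.
Import Order.TTheory GRing.Theory Num.Theory.
Local Open Scope classical_set_scope.
Local Open Scope ring_scope.

Definition word := seq bool.

Definition language := set word.

(* The successor function of the length-lexicographic order, on words written
   with their last letter first. *)
Fixpoint rev_succ (w : word) : word :=
  match w with
  | [::] => [:: false]
  | false :: w' => true :: w'
  | true :: w' => false :: rev_succ w'
  end.

Definition llword (n : nat) : word := rev (iter n rev_succ [::]).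

Definition char_prefix (A : language) (n : nat) : word :=
  mkseq (fun k => llword k \in A) n.

(** * Multitape Turing machines with a function oracle *)

(* [None] is the blank. *)
Definition symbol := option bool.

(* A two-way infinite tape: (cells left of the head, nearest first;
   scanned cell followed by the cells to its right).  Unlisted cells are
   blank. *)
Definition tape := (seq symbol * seq symbol)%type.

Definition read (t : tape) : symbol := head None t.2.

Definition write (s : symbol) (t : tape) : tape := (t.1, s :: behead t.2).

Definition move_right (t : tape) : tape := (read t :: t.1, behead t.2).

Definition move_left (t : tape) : tape := (behead t.1, head None t.1 :: t.2).

Definition tape_of_word (w : word) : tape := ([::], map Some w).

(* The word that starts at the scanned cell and ends before the next blank. *)
Fixpoint leading_word (s : seq symbol) : word :=
  if s is Some b :: s' then b :: leading_word s' else [::].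

Definition word_of_tape (t : tape) : word := leading_word t.2.

(* The finite control is a list of instructions, the state being an index in
   this list.  [Branch i lblank l0 l1] jumps according to the symbol scanned on
   tape [i]; [Query i j] replaces the contents of tape [j] by the oracle's
   answer to the word on tape [i].  The other instructions go on to the next
   state.  A machine only uses the finitely many tapes that occur in it. *)
Inductive instr : Type :=
  | Write (i : nat) (s : symbol)
  | MoveLeft (i : nat)
  | MoveRight (i : nat)
  | Branch (i lblank l0 l1 : nat)
  | Query (i j : nat).

Definition machine := seq instr.

Record config := Config { state : nat; tapes : nat -> tape }.

Definition set_tape (T : nat -> tape) (i : nat) (t : tape) : nat -> tape :=
  fun j => if j == i then t else T j.

Definition step (g : word -> word) (c : instr) (x : config) : config :=
  let: Config q T := x in
  match c with
  | Write i s => Config q.+1 (set_tape T i (write s (T i)))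
  | MoveLeft i => Config q.+1 (set_tape T i (move_left (T i)))
  | MoveRight i => Config q.+1 (set_tape T i (move_right (T i)))
  | Branch i lblank l0 l1 =>
      Config (match read (T i) with
              | None => lblank
              | Some false => l0
              | Some true => l1
              end) T
  | Query i j =>
      Config q.+1 (set_tape T j (tape_of_word (g (word_of_tape (T i)))))
  end.

(* Every instruction takes one unit of time, except that an oracle answer is
   charged its length in addition. *)
Definition cost (g : word -> word) (c : instr) (x : config) : nat :=
  if c is Query i _ then (size (g (word_of_tape (tapes x i)))).+1 else 1%N.

(* [runs g M x t y]: from [x], the machine halts in [y] after time [t].  It
   halts when its state is not the index of an instruction. *)
Inductive runs (g : word -> word) (M : machine) :
    config -> nat -> config -> Prop :=
  | runs_halt x : (size M <= state x)%N -> runs g M x 0 x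
  | runs_step x c t y : onth M (state x) = Some c ->
      runs g M (step g c x) t y -> runs g M x (cost g c x + t) y.

(* The arguments are on the tapes 0, 1, ..., all other tapes being blank. *)
Definition init (xs : seq word) : config :=
  Config 0 (fun i => tape_of_word (nth [::] xs i)).

Definition in_pg (g : word -> word) (n : nat) (f : n.-tuple word -> word) :
    Prop :=
  exists (M : machine) (p : {poly nat}), forall xs : n.-tuple word,
    exists (t : nat) (y : config),
      [/\ runs g M (init xs) t y,
          (t <= p.[sumn (map size xs)])%N &
          word_of_tape (tapes y 0) = f xs].

(** * Rational outputs *)

(* Binary, least significant bit first. *)
Fixpoint nat_of_word (w : word) : nat :=
  if w is b :: w' then (b + (nat_of_word w').*2)%N else 0%N.

Fixpoint deinterleave (w : word) : word * word :=
  match w with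
  | a :: b :: w' => let: (u, v) := deinterleave w' in (a :: u, b :: v)
  | _ => (w, [::])
  end.

(* A sign bit, followed by the interleaved bits of the numerator and of the
   denominator.  Fractions need not be reduced; n / 0 is 0. *)
Definition rat_of_word (w : word) : rat :=
  if w is b :: w' then
    let: (u, v) := deinterleave w' in
    (-1) ^+ b * (nat_of_word u)%:R / (nat_of_word v)%:R
  else 0.

(** * Gales and dimension *)

Definition pg_computable (R : realType) (g : word -> word) (d : word -> R) :
    Prop :=
  exists f : 2.-tuple word -> word, in_pg g f /\
    forall (w : word) (r : nat),
      `|ratr (rat_of_word (f [tuple w; nseq r true])) - d w| <= 2 ^- r.

Definition pg_computable_real (R : realType) (g : word -> word) (x : R) :
    Prop :=
  pg_computable g (fun _ : word => x).

Definition positive_distribution (R : realType) (beta : bool -> R) : Prop :=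
  (forall b, 0 < beta b) /\ beta false + beta true = 1.

Definition uniform (R : realType) (b : bool) : R := 2^-1.

Definition gale (R : realType) (beta : bool -> R) (s : R) (d : word -> R) :
    Prop :=
  (forall w, 0 <= d w) /\
  (forall w, d w = d (rcons w false) * beta false `^ s
                   + d (rcons w true) * beta true `^ s).

Definition succeeds (R : realType) (d : word -> R) (A : language) : Prop :=
  limn_esup (fun n => (d (char_prefix A n))%:E) = +oo%E.

(* The infimum is taken in the extended reals: it is +oo if there is no such
   exponent. *)
Definition dim_pg_beta (R : realType) (g : word -> word) (beta : bool -> R)
    (X : set language) : \bar R :=
  ereal_inf [set s%:E | s in [set s : R | 0 <= s /\
    exists d : word -> R, [/\ gale beta s d, pg_computable g d &
      forall A, X A -> succeeds d A]]].

Definition dim_pg (R : realType) (g : word -> word) (X : set language) :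
    \bar R :=
  dim_pg_beta g (@uniform R) X.

(* Main.v *)
(* Let d be a p^g-computable s-gale with s small and d(empty) > 0 (otherwise
   d = 0), and put c = 2^-s.  Then d'(w) = d(w) * prod_i c / sqrt (beta w_i) is a
   beta-(1/2)-gale.  If s is so small that c >= sqrt (beta b) for both letters b,
   all factors are at least 1, so that d' >= d succeeds wherever d does, and the
   beta-dimension is at most 1/2.

   The gale d' is again p^g-computable although s need not be a computable
   real: c = d(empty) / (d(0) + d(1)), and sqrt b is the limit of the iteration
   y <- (b + y) / (1 + y) from y = 1.  This iteration converges geometrically,
   and its numerators and denominators grow only linearly in length when it is
   carried out exactly on fractions, so no rounding is needed.  Evaluating all
   gale values and both beta's with precision proportional to |w| + r + 1 absorbs
   the loss of accuracy in the product of |w| factors. *)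
Require Import Defs.
From mathcomp Require Import all_boot all_order all_algebra.
From mathcomp Require Import all_classical all_reals all_analysis.
From mathcomp Require Import zify ring lra.
Set Implicit Arguments.
Unset Strict Implicit.
Unset Printing Implicit Defensive.
Import Order.TTheory GRing.Theory Num.Theory.
Import numFieldNormedType.Exports.

(** * Oracle machines from structured programs *)

Section Tapes.

(** For the gale argument any exponent t strictly between 0 and 1 would serve: the factors c /
    beta(b)^t turn d into a beta-t-gale and are at least 1 once s is small. The choice t = 1/2 makes
    beta(b)^t a square root, hence the limit of a rational iteration. Membership in [in_pg] asks for
    an explicit machine, and this shapes most of the development. The machines that compute d and
    beta are arbitrary and leave unknown garbage on their tapes, so they cannot be put into a loop
    that reuses tapes. But d' needs only six of their values: d at w, at the empty word, at 0 and at
    1, and beta at both letters. Hence there are two kinds of programs: clean ones, which leave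
    their scratch tapes blank and can be iterated, and stages that may call a given machine on fresh
    tapes, which are then given up. All loops over data belong to the clean kind and perform exact
    integer arithmetic on binary words. *)

Definition tape_eq (t u : tape) : Prop :=
  (forall k, nth None t.1 k = nth None u.1 k) /\
  (forall k, nth None t.2 k = nth None u.2 k).

Lemma tape_eq_refl t : tape_eq t t. Proof. by []. Qed.

Lemma tape_eq_sym t u : tape_eq t u -> tape_eq u t.
Proof. by case=> h1 h2; split=> k; rewrite ?h1 ?h2. Qed.

Lemma tape_eq_trans t u v : tape_eq t u -> tape_eq u v -> tape_eq t v.
Proof.
by case=> h1 h2 [h3 h4]; split=> k; [rewrite h1 h3 | rewrite h2 h4].
Qed.

Lemma read_nth t : read t = nth None t.2 0.
Proof. by rewrite /read nth0. Qed.

Lemma read_eq t u : tape_eq t u -> read t = read u.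
Proof. by case=> _ h; rewrite !read_nth h. Qed.

Lemma write_eq s t u : tape_eq t u -> tape_eq (write s t) (write s u).
Proof.
case=> h1 h2; split=> k //=; case: k => [|k] //=.
by rewrite !nth_behead.
Qed.

Lemma move_right_eq t u : tape_eq t u -> tape_eq (move_right t) (move_right u).
Proof.
move=> h; have := read_eq h; case: h => h1 h2 hr; split=> k /=.
  by case: k => [|k] //=.
by rewrite !nth_behead.
Qed.

Lemma move_left_eq t u : tape_eq t u -> tape_eq (move_left t) (move_left u).
Proof.
case=> h1 h2; split=> k /=; first by rewrite !nth_behead.
by case: k => [|k] //=; rewrite -!nth0 h1.
Qed.

Lemma leading_word_eq s s' : (forall k, nth None s k = nth None s' k) ->
  leading_word s = leading_word s'.
Proof.
elim: s s' => [|a s ih] [|b s'] h //=.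
- by have /= <- := h 0.
- by have /= -> := h 0.
have /= <- := h 0; case: a {h} (fun k => h k.+1) => [a|] //= h.
by rewrite (ih s').
Qed.

Lemma word_of_tape_eq t u : tape_eq t u -> word_of_tape t = word_of_tape u.
Proof. by case=> _; exact: leading_word_eq. Qed.

(** Equality is cell by cell, because erasures and moves past an end list blanks explicitly. It also
    makes all cells left of the head blank, so the tape is a stack with its top under the head. *)
Definition holds (t : tape) (w : word) := tape_eq t (tape_of_word w).

Lemma holds_tape_of_word w : holds (tape_of_word w) w.
Proof. exact: tape_eq_refl. Qed.

Lemma word_of_tapeK w : word_of_tape (tape_of_word w) = w.
Proof. by rewrite /word_of_tape /=; elim: w => //= b w ->. Qed.

Lemma word_of_holds t w : holds t w -> word_of_tape t = w.
Proof. by move/word_of_tape_eq; rewrite word_of_tapeK. Qed.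

Lemma read_holds t w : holds t w -> read t = ohead w.
Proof. by move/read_eq ->; case: w. Qed.

Definition tape_push (b : bool) (t : tape) := write (Some b) (move_left t).
Definition tape_pop (t : tape) := move_right (write None t).

Lemma holds_push b t w : holds t w -> holds (tape_push b t) (b :: w).
Proof.
move=> h; have := write_eq (Some b) (move_left_eq h).
by move/tape_eq_trans; apply; split.
Qed.

Lemma holds_pop t w : holds t w -> holds (tape_pop t) (behead w).
Proof.
move=> h; have := move_right_eq (write_eq None h).
by move/tape_eq_trans; apply; split; case: w {h} => [|b w] //= [|[]].
Qed.

(** Nothing is assumed about the cells beyond the leading word, unlike in [holds_pop]: this serves
    to read the output of an unknown machine. *)
Lemma word_of_tape_pop t b w : word_of_tape t = b :: w ->
  word_of_tape (tape_pop t) = w.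
Proof. by case: t => l [|[c|] r] //= []. Qed.

Lemma read_word_of_tape t : read t = ohead (word_of_tape t).
Proof. by case: t => l [|[b|] r]. Qed.

End Tapes.

(** * Structured programs and their compilation *)

Inductive cmd : Type :=
  | Skip
  | Push (i : nat) (b : bool)
  | Pop (i : nat)
  | Seq (c d : cmd)
  (* a blank counts as [false] *)
  | If (i : nat) (c0 c1 : cmd)
  (* while tape [i] does not scan a blank *)
  | While (i : nat) (c0 c1 : cmd)
  | Raw (M : machine).

Section Exec.
Variable g : word -> word.

(** The times are exact for the compiled code: the 2 in [exec_if] and [exec_while_go] is a branch
    plus the closing jump. No command queries the oracle; this happens only in machines embedded by
    [Raw]. *)
Inductive exec : cmd -> (nat -> tape) -> nat -> (nat -> tape) -> Prop :=
  | exec_skip T : exec Skip T 0 T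
  | exec_push i b T : exec (Push i b) T 2 (set_tape T i (tape_push b (T i)))
  | exec_pop i T : exec (Pop i) T 2 (set_tape T i (tape_pop (T i)))
  | exec_seq c d T t T1 t' T2 : exec c T t T1 -> exec d T1 t' T2 ->
      exec (Seq c d) T (t + t') T2
  | exec_if i c0 c1 T t T1 :
      exec (if read (T i) == Some true then c1 else c0) T t T1 ->
      exec (If i c0 c1) T t.+2 T1
  | exec_while_stop i c0 c1 T : read (T i) = None -> exec (While i c0 c1) T 1 T
  | exec_while_go i c0 c1 b T t T1 t' T2 : read (T i) = Some b ->
      exec (if b then c1 else c0) T t T1 ->
      exec (While i c0 c1) T1 t' T2 ->
      exec (While i c0 c1) T (t.+2 + t') T2
  | exec_raw M T t y : runs g M (Config 0 T) t y -> exec (Raw M) T t (tapes y).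

(** A target outside the embedded code is a halting state of the machine; it becomes a jump to the
    exit [e]. *)
Definition reloc (q e k : nat) (l : nat) := if l < k then q + l else e.

Definition reloc_instr (q k : nat) (c : instr) : instr :=
  if c is Branch i lb l0 l1 then
    Branch i (reloc q (q + k) k lb) (reloc q (q + k) k l0)
             (reloc q (q + k) k l1)
  else c.

Definition jump (e : nat) : instr := Branch 0 e e e.

Fixpoint clen (c : cmd) : nat :=
  match c with
  | Skip => 0
  | Push _ _ | Pop _ => 2
  | Seq c d => clen c + clen d
  | If _ c0 c1 | While _ c0 c1 => (clen c0 + clen c1).+3
  | Raw M => size M
  end.

Fixpoint compile (q : nat) (c : cmd) : machine :=
  match c with
  | Skip => [::]
  | Push i b => [:: MoveLeft i; Write i (Some b)]
  | Pop i => [:: Write i None; MoveRight i]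
  | Seq c d => compile q c ++ compile (q + clen c) d
  | If i c0 c1 =>
      let q0 := q.+1 in let q1 := q0 + (clen c0).+1 in
      let e := q1 + (clen c1).+1 in
      Branch i q0 q0 q1 :: (compile q0 c0 ++ [:: jump e]) ++
        (compile q1 c1 ++ [:: jump e])
  | While i c0 c1 =>
      let q0 := q.+1 in let q1 := q0 + (clen c0).+1 in
      let e := q1 + (clen c1).+1 in
      Branch i e q0 q1 :: (compile q0 c0 ++ [:: jump q]) ++
        (compile q1 c1 ++ [:: jump q])
  | Raw M => map (reloc_instr q (size M)) M
  end.

Lemma size_compile q c : size (compile q c) = clen c.
Proof.
elim: c q => //=.
- by move=> c ihc d ihd q; rewrite size_cat ihc ihd.
- by move=> i c ihc d ihd q; rewrite !size_cat ihc ihd /=; lia.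
- by move=> i c ihc d ihd q; rewrite !size_cat ihc ihd /=; lia.
by move=> M q; rewrite size_map.
Qed.

Definition code_at (M : machine) (q : nat) (s : machine) :=
  forall i, i < size s -> onth M (q + i) = onth s i.

Lemma code_at_cat M q s s' : code_at M q (s ++ s') <->
  code_at M q s /\ code_at M (q + size s) s'.
Proof.
split=> [h|[h1 h2] i].
  split=> i hi.
    by rewrite h ?size_cat ?onth_cat ?hi //; lia.
  rewrite -addnA h ?size_cat ?onth_cat; last lia.
  by rewrite ltnNge leq_addr /= addKn.
rewrite size_cat onth_cat => hi; case: ltnP => hi'; first exact: h1.
by rewrite -h2 -?addnA ?subnKC //; lia.
Qed.

Lemma code_at_cons M q c s : code_at M q (c :: s) <->
  onth M q = Some c /\ code_at M q.+1 s.
Proof.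
rewrite -cat1s code_at_cat addn1; split=> [[h1 h2]|[h1 h2]]; split=> //.
  by have := h1 0; rewrite addn0; apply.
by case=> [|i] //=; rewrite addn0.
Qed.

Lemma runs_eq M x t t' y : runs g M x t y -> t = t' -> runs g M x t' y.
Proof. by move=> h <-. Qed.

Lemma runs_jump M q e T t y : onth M q = Some (jump e) ->
  runs g M (Config e T) t y -> runs g M (Config q T) t.+1 y.
Proof.
move=> hq h; rewrite -add1n.
apply: (@runs_step _ _ (Config q T) (jump e)) => //=.
by case: (read _) => [[]|].
Qed.

(* Continuation form: running the compiled code prolongs any run that starts
   at its end. *)
Lemma exec_runs c T t T' : exec c T t T' -> forall M q,
  code_at M q (compile q c) -> forall t' y,
  runs g M (Config (q + clen c) T') t' y -> runs g M (Config q T) (t + t') y.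
Proof.
elim=> {c T t T'} /=.
- by move=> T M q _ t' y; rewrite addn0.
- move=> i b T M q /code_at_cons[h1 /code_at_cons[h2 _]] t' y h.
  have := @runs_step g M (Config q T) _ (1 + t') y h1; apply.
  apply: (@runs_step g M (Config q.+1 _) _ t' y h2) => /=.
  move: h; rewrite addn2 /tape_push; congr runs; congr Config.
  apply/funext => j; rewrite /set_tape; case: eqP => // _.
  by rewrite eqxx.
- move=> i T M q /code_at_cons[h1 /code_at_cons[h2 _]] t' y h.
  have := @runs_step g M (Config q T) _ (1 + t') y h1; apply.
  apply: (@runs_step g M (Config q.+1 _) _ t' y h2) => /=.
  move: h; rewrite addn2 /tape_pop; congr runs; congr Config.
  apply/funext => j; rewrite /set_tape; case: eqP => // _.
  by rewrite eqxx.
- move=> c d T t T1 t' T2 _ ihc _ ihd M q.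
  rewrite code_at_cat size_compile => -[hc hd] s y.
  rewrite -[t + t' + s]addnA [q + (_ + _)]addnA => h.
  by apply: ihc => //; apply: ihd.
- move=> i c0 c1 T t T1 _ ih M q /code_at_cons[hb].
  rewrite !code_at_cat !size_cat !size_compile /= !addn1 => -[[h0 j0] [h1 j1]] s y h.
  set q1 := q.+1 + (clen c0).+1 in h1 j1 hb j0.
  apply: (@runs_eq _ _ (1 + (t + s.+1))); last lia.
  apply: (@runs_step g M (Config q T) _ _ _ hb) => /=.
  have {}j0 : onth M (q.+1 + clen c0) = Some (jump (q1 + (clen c1).+1)).
    by have := j0 0 isT; rewrite addn0.
  have {}j1 : onth M (q1 + clen c1) = Some (jump (q1 + (clen c1).+1)).
    by have := j1 0 isT; rewrite addn0.
  case: eqP ih => [->|hr] ih.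
    apply: ih; first by [].
    apply: (runs_jump j1).
    by move: h; congr runs; congr Config; rewrite /q1; lia.
  have : runs g M (Config q.+1 T) (t + s.+1) y.
    apply: ih => //; apply: (runs_jump j0).
    by move: h; congr runs; congr Config; rewrite /q1; lia.
  by case: (read _) hr => [[]|].
- move=> i c0 c1 T hr M q /code_at_cons[hb _] s y h.
  apply: (@runs_step g M (Config q T) _ _ _ hb) => /=; rewrite hr.
  by move: h; congr runs; congr Config; lia.
- move=> i c0 c1 b T t T1 t' T2 hr _ ih1 _ ih2 M q hM s y h.
  have := hM => /code_at_cons[hb].
  rewrite !code_at_cat !size_cat !size_compile /= !addn1 => -[[h0 j0] [h1 j1]].
  set q1 := q.+1 + (clen c0).+1 in h1 j1 hb j0.
  have hw : runs g M (Config q T1) (t' + s) y by apply: ih2.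
  apply: (@runs_eq _ _ (1 + (t + (t' + s).+1))); last lia.
  apply: (@runs_step g M (Config q T) _ _ _ hb) => /=; rewrite hr.
  have {}j0 : onth M (q.+1 + clen c0) = Some (jump (q)).
    by have := j0 0 isT; rewrite addn0.
  have {}j1 : onth M (q1 + clen c1) = Some (jump (q)).
    by have := j1 0 isT; rewrite addn0.
  case: b hr ih1 => hr ih1.
    apply: ih1; first by [].
    exact: (runs_jump j1).
  by apply: ih1 => //; exact: (runs_jump j0).
move=> M0 T t y h M q hM s z.
move: h; set x := Config 0 T => h.
rewrite -[in X in _ -> X](addn0 q).
rewrite -[0 in X in _ -> X]/(state x) -[T in X in _ -> X]/(tapes x).
(* The induction on the run needs an arbitrary start state; relocation sends a halting one to the
   exit. *)
suff H : forall x t y, runs g M0 x t y ->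
  runs g M (Config (q + size M0) (tapes y)) s z ->
  runs g M (Config (reloc q (q + size M0) (size M0) (state x)) (tapes x))
    (t + s) z.
  move=> hz; have := H _ _ _ h hz; rewrite /reloc; case: ltnP => //=.
  by rewrite leqn0 => /eqP ->.
move=> {x T t y h} x t y; elim=> {x t y}.
  by move=> x hx; rewrite /reloc ltnNge hx /= add0n.
move=> x c t y hc _ ih hz.
have lt_x : state x < size M0 by rewrite -onthTE hc.
have hc' : onth M (q + state x) = Some (reloc_instr q (size M0) c).
  rewrite hM ?size_map //; elim: M0 (state x) {hM hz ih lt_x} hc (size M0) => //.
    by case.
  move=> a l ih [|k] //=; first by case=> ->.
  by move=> hk n; apply: ih.
have -> : reloc q (q + size M0) (size M0) (state x) = q + state x.
  by rewrite /reloc lt_x.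
move: (ih hz); rewrite -addnA.
(* Falling through from the last instruction arrives at the exit: [q + size M0] is both the next
   index and the image of all halting states. *)
have nb q' : reloc q (q + size M0) (size M0) (state x).+1 = q' ->
    q' = (q + state x).+1.
  move=> <-; rewrite /reloc; case: ltnP; lia.
case: x c hc hc' lt_x nb {ih} => n T [i s'|i|i|i l l0 l1|i j] /= _ hc' _ nb h;
  have := @runs_step g M (Config (q + n) T) _ (t + s) z hc'; apply => //=;
  try by move: h; rewrite (nb _ erefl).
by move: h; case: (read (T i)) => [[]|].
Qed.

Lemma exec_machine c T t T' : exec c T t T' ->
  runs g (compile 0 c) (Config 0 T) t (Config (clen c) T').
Proof.
move=> h; rewrite -[t]addn0; apply: (exec_runs h) => //.
by apply: runs_halt; rewrite /= size_compile.
Qed.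

End Exec.

(** * Moving a program to higher tapes *)

Section Shift.
Variable g : word -> word.
Variable a : nat.

Definition shift_instr (c : instr) : instr :=
  match c with
  | Write i s => Write (a + i) s
  | MoveLeft i => MoveLeft (a + i)
  | MoveRight i => MoveRight (a + i)
  | Branch i l l0 l1 => Branch (a + i) l l0 l1
  | Query i j => Query (a + i) (a + j)
  end.

Fixpoint shift_cmd (c : cmd) : cmd :=
  match c with
  | Skip => Skip
  | Push i b => Push (a + i) b
  | Pop i => Pop (a + i)
  | Seq c d => Seq (shift_cmd c) (shift_cmd d)
  | If i c d => If (a + i) (shift_cmd c) (shift_cmd d)
  | While i c d => While (a + i) (shift_cmd c) (shift_cmd d)
  | Raw M => Raw (map shift_instr M)
  end.

Definition glue_tapes (U T : nat -> tape) : nat -> tape :=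
  fun j => if j < a then U j else T (j - a).

Lemma glue_tapes_shift U T i : glue_tapes U T (a + i) = T i.
Proof. by rewrite /glue_tapes ltnNge leq_addr addKn. Qed.

Lemma glue_tapes_id U : glue_tapes U (fun i => U (a + i)) = U.
Proof.
by apply/funext => j; rewrite /glue_tapes; case: ltnP => // h; rewrite subnKC.
Qed.

Lemma glue_tapes_set U T i x :
  set_tape (glue_tapes U T) (a + i) x = glue_tapes U (set_tape T i x).
Proof.
apply/funext => j; rewrite /glue_tapes /set_tape.
case: ltnP => h; first by case: eqP => //; lia.
by rewrite -(eqn_add2l a (j - a)) subnKC.
Qed.

Lemma runs_shift M x t y U : runs g M x t y ->
  runs g (map shift_instr M) (Config (state x) (glue_tapes U (tapes x))) t
    (Config (state y) (glue_tapes U (tapes y))).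
Proof.
elim=> {x t y} [x hx|x c t y hc _ ih].
  by apply: runs_halt; rewrite size_map.
have hc' : onth (map shift_instr M) (state x) = Some (shift_instr c).
  by move: hc; elim: M (state x) {ih} => [|d M ih] [|k] //= => [[->]|/ih].
set X := Config _ _; have -> : cost g c x = cost g (shift_instr c) X.
  by case: c {hc hc' ih} => //= i j; rewrite glue_tapes_shift.
apply: (@runs_step g _ X _ _ _ hc'); move: ih.
case: x @X {hc hc'} => q T /=.
by case: c => [i s|i|i|i l l0 l1|i j] /=; rewrite ?glue_tapes_shift ?glue_tapes_set.
Qed.

Lemma exec_shift c T t T' U : exec g c T t T' ->
  exec g (shift_cmd c) (glue_tapes U T) t (glue_tapes U T').
Proof.
elim=> {c T t T'} /=.
- by move=> T; exact: exec_skip.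
- move=> i b T; rewrite -glue_tapes_set -[X in tape_push _ X](glue_tapes_shift U).
  exact: exec_push.
- move=> i T; rewrite -glue_tapes_set -[X in tape_pop X](glue_tapes_shift U).
  exact: exec_pop.
- by move=> *; apply: exec_seq; eauto.
- move=> i c0 c1 T t T1 _ ih; apply: exec_if.
  by rewrite glue_tapes_shift; case: ifP ih.
- by move=> i c0 c1 T h; apply: exec_while_stop; rewrite glue_tapes_shift.
- move=> i c0 c1 b T t T1 t' T2 h _ ih1 _ ih2.
  apply: (@exec_while_go _ _ _ _ b) ih2; rewrite ?glue_tapes_shift //.
  by case: b ih1 {h}.
move=> M T t y h.
exact: (exec_raw (runs_shift U h)).
Qed.

End Shift.

(** * Invariants of machine runs *)

Section Runs.
Variable g : word -> word.

(** Needed for calls: a given machine is specified on the literal tapes of [init], while registers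
    agree with them only cell by cell. *)
Lemma runs_tape_eq M x t y : runs g M x t y -> forall T,
  (forall i, tape_eq (tapes x i) (T i)) ->
  exists y', runs g M (Config (state x) T) t y' /\
    forall i, tape_eq (tapes y i) (tapes y' i).
Proof.
elim=> {x t y} [x hx|x c t y hc _ ih] T hT.
  by exists (Config (state x) T); split=> //; exact: runs_halt.
have [|y' [h1 h2]] := ih (tapes (step g c (Config (state x) T))).
  case: x hT {hc ih} => q S /= hT.
  case: c => [i s|i|i|i l l0 l1|i j] k //=; rewrite /set_tape; case: eqP => // _.
  - exact: write_eq.
  - exact: move_left_eq.
  - exact: move_right_eq.
  by rewrite (word_of_tape_eq (hT i)); exact: tape_eq_refl.
exists y'; split=> //.
set X := Config (state x) T in h1 *; have -> : cost g c x = cost g c X.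
  by case: c {hc h1 ih} => //= i j; rewrite (word_of_tape_eq (hT i)).
apply: (@runs_step g _ X _ _ _ hc); move: h1; rewrite /X.
case: x hT {ih X hc} => q S /= hT.
by case: c => //= i l l0 l1; rewrite (read_eq (hT i)).
Qed.

(** Shifted by one, with 0 for no tape, so that the maximum in [tape_bound] strictly exceeds every
    tape that can change. *)
Definition written_tape (c : instr) : nat :=
  match c with
  | Write i _ | MoveLeft i | MoveRight i => i.+1
  | Branch _ _ _ _ => 0
  | Query _ j => j.+1
  end.

Definition tape_bound (M : machine) :=
  foldr (fun c m => maxn (written_tape c) m) 0 M.

Lemma runs_tape_bound M x t y : runs g M x t y ->
  forall i, tape_bound M <= i -> tapes y i = tapes x i.
Proof.
elim=> {x t y} [//|x c t y hc _ ih] i hi; rewrite ih //.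
have {hc hi ih} : written_tape c <= i.
  apply: leq_trans hi; elim: M (state x) hc {ih} => [|d M ih] [|k] //=.
    by case=> ->; rewrite leq_max leqnn.
  by move/ih; rewrite leq_max => ->; rewrite orbT.
by case: x => q T; case: c => //= [j s|j|j|k j]; rewrite /set_tape;
  case: eqP => //; lia.
Qed.

(** The charge for the length of an oracle answer makes this true: a query can replace a tape by a
    long word only at that cost. It bounds the output of a called machine by input size plus
    time. *)
Lemma runs_size M x t y : runs g M x t y -> forall B,
  (forall i, size (tapes x i).2 <= B) ->
  forall i, size (tapes y i).2 <= B + t.
Proof.
elim=> {x t y} [x _|x c t y hc _ ih] B hB i; first by rewrite addn0.
rewrite addnA; apply: ih => {}i; case: x hB {hc} => q T /= hB.
case: c => [j s|j|j|j l l0 l1|k j] /=; rewrite /set_tape;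
  try case: eqP => /= _; rewrite ?size_behead ?size_map.
- by have := hB j; lia.
- by have := hB i; lia.
- by have := hB j; lia.
- by have := hB i; lia.
- by have := hB j; lia.
- by have := hB i; lia.
- by have := hB i; lia.
- by lia.
- by have := hB i; lia.
Qed.

Lemma size_word_of_tape t : size (word_of_tape t) <= size t.2.
Proof.
by case: t => l s; rewrite /word_of_tape /=; elim: s => [|[b|] s ih].
Qed.

End Runs.

(** * Programs acting on registers *)

Section Reg.
Variable g : word -> word.

Definition upd (e : nat -> word) i w : nat -> word :=
  fun j => if j == i then w else e j.

(* The tapes in [D] are registers: [c] takes the register contents [e] to [e']
   in time at most [t] and does not touch the other tapes. *)
Variant reg (D : pred nat) (c : cmd) (e : nat -> word) (t : nat)
    (e' : nat -> word) : Prop :=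
  | Reg of forall T,
      (forall i, D i -> holds (T i) (e i)) -> exists t' T',
      [/\ t' <= t, exec g c T t' T', (forall i, D i -> holds (T' i) (e' i)) &
          forall i, ~~ D i -> T' i = T i].

Lemma regP D c e t e' : reg D c e t e' -> forall T,
  (forall i, D i -> holds (T i) (e i)) -> exists t' T',
  [/\ t' <= t, exec g c T t' T', (forall i, D i -> holds (T' i) (e' i)) &
      forall i, ~~ D i -> T' i = T i].
Proof. by case. Qed.

Lemma reg_skip D e : reg D Skip e 0 e.
Proof. by split=> T h; exists 0, T; split=> //; exact: exec_skip. Qed.

Lemma reg_push (D : pred nat) e i b : D i ->
  reg D (Push i b) e 2 (upd e i (b :: e i)).
Proof.
move=> Di; split=> T h; exists 2, (set_tape T i (tape_push b (T i))); split=> //.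
- exact: exec_push.
- move=> j Dj; rewrite /set_tape /upd; case: eqP => _; last exact: h.
  exact: holds_push (h _ Di).
by move=> j; rewrite /set_tape; case: eqP => // ->; rewrite Di.
Qed.

Lemma reg_pop (D : pred nat) e i : D i ->
  reg D (Pop i) e 2 (upd e i (behead (e i))).
Proof.
move=> Di; split=> T h; exists 2, (set_tape T i (tape_pop (T i))); split=> //.
- exact: exec_pop.
- move=> j Dj; rewrite /set_tape /upd; case: eqP => _; last exact: h.
  exact: holds_pop (h _ Di).
by move=> j; rewrite /set_tape; case: eqP => // ->; rewrite Di.
Qed.

Lemma reg_seq D c d e t e1 t' e2 : reg D c e t e1 -> reg D d e1 t' e2 ->
  reg D (Seq c d) e (t + t') e2.
Proof.
move=> hc hd; split=> T h; have [s [T1 [hs h1 h2 h3]]] := regP hc h.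
have [s' [T2 [hs' h1' h2' h3']]] := regP hd h2.
exists (s + s'), T2; split=> //; first exact: leq_add.
  exact: exec_seq h1 h1'.
by move=> i Di; rewrite h3' ?h3.
Qed.

Lemma reg_if (D : pred nat) i c0 c1 e t e' : D i ->
  reg D (if head false (e i) then c1 else c0) e t e' ->
  reg D (If i c0 c1) e t.+2 e'.
Proof.
move=> Di hc; split=> T h; have [s [T1 [hs h1 h2 h3]]] := regP hc h.
exists s.+2, T1; split=> //; apply: exec_if.
by rewrite (read_holds (h _ Di)); case: (e i) h1 => [|[] w] h1; exact: h1.
Qed.

Lemma reg_while0 (D : pred nat) i c0 c1 e : D i -> e i = [::] ->
  reg D (While i c0 c1) e 1 e.
Proof.
move=> Di ei; split=> T h; exists 1, T; split=> //; apply: exec_while_stop.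
by rewrite (read_holds (h _ Di)) ei.
Qed.

Lemma reg_whileS (D : pred nat) i c0 c1 e b w t e1 t' e2 : D i ->
  e i = b :: w -> reg D (if b then c1 else c0) e t e1 ->
  reg D (While i c0 c1) e1 t' e2 -> reg D (While i c0 c1) e (t.+2 + t') e2.
Proof.
move=> Di ei hc hd; split=> T h; have [s [T1 [hs h1 h2 h3]]] := regP hc h.
have [s' [T2 [hs' h1' h2' h3']]] := regP hd h2.
exists (s.+2 + s'), T2; split=> //; first by rewrite leq_add.
  by apply: exec_while_go h1 h1'; rewrite (read_holds (h _ Di)) ei.
by move=> j Dj; rewrite h3' ?h3.
Qed.

Lemma reg_ext (D : pred nat) c e t e' f f' : reg D c e t e' ->
  (forall i, D i -> e i = f i) -> (forall i, D i -> e' i = f' i) ->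
  reg D c f t f'.
Proof.
move=> hc he he'; split=> T h.
have [i Di|s [T1 [hs h1 h2 h3]]] := @regP _ _ _ _ _ hc T.
  by rewrite he //; exact: h.
by exists s, T1; split=> // i Di; rewrite -he' //; exact: h2.
Qed.

Lemma reg_le D c e t e' t' : reg D c e t e' -> t <= t' -> reg D c e t' e'.
Proof.
move=> hc le; split=> T h; have [s [T1 [hs h1 h2 h3]]] := regP hc h.
by exists s, T1; split=> //; exact: leq_trans le.
Qed.

Lemma reg_sub (D D' : pred nat) c e t e' : reg D c e t e' ->
  (forall i, D i -> D' i) -> (forall i, D' i -> ~~ D i -> e i = e' i) ->
  reg D' c e t e'.
Proof.
move=> hc sub he; split=> T h; have [|s [T1 [hs h1 h2 h3]]] := @regP _ _ _ _ _ hc T.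
  by move=> i /sub; exact: h.
exists s, T1; split=> //.
  move=> i D'i; have [/h2 //|nDi] := boolP (D i).
  by rewrite h3 // -he //; exact: h.
by move=> i nD'i; rewrite h3 //; apply: contra nD'i; exact: sub.
Qed.

Lemma reg_shift a (D : pred nat) c e t e' : reg D c e t e' ->
  reg (fun j => (a <= j) && D (j - a)) (shift_cmd a c) (fun j => e (j - a)) t
    (fun j => e' (j - a)).
Proof.
move=> hc; split=> T h.
have [|s [T1 [hs h1 h2 h3]]] := @regP _ _ _ _ _ hc (fun i => T (a + i)).
  move=> i Di; have := h (a + i); rewrite leq_addr addKn => h'.
  exact: h'.
exists s, (glue_tapes a T T1); split=> //.
- by have := exec_shift a T h1; rewrite glue_tapes_id.
- by move=> i /andP[ai Di]; rewrite /glue_tapes ltnNge ai; exact: h2.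
move=> i; rewrite /glue_tapes; case: ltnP => //= ai nDi.
by rewrite h3 // subnKC.
Qed.

Definition mvrev i j :=
  While i (Seq (Pop i) (Push j false)) (Seq (Pop i) (Push j true)).

Lemma reg_mvrev (D : pred nat) i j e : D i -> D j -> i != j ->
  reg D (mvrev i j) e (6 * size (e i) + 1)
    (upd (upd e j (catrev (e i) (e j))) i [::]).
Proof.
move=> Di Dj nij; move ei: (e i) => w; elim: w e ei => [|b w ih] e ei /=.
  apply: (reg_ext (reg_while0 _ _ Di ei)) => // k _.
  by rewrite /upd; case: eqP => [->//|_]; case: eqP => // ->.
have h1 : reg D (if b then Seq (Pop i) (Push j true)
    else Seq (Pop i) (Push j false)) e 4 (upd (upd e i w) j (b :: e j)).
  have -> : (if b then Seq (Pop i) (Push j true) else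
     Seq (Pop i) (Push j false)) = Seq (Pop i) (Push j b) by case: b {ei}.
  apply: (reg_ext (reg_seq (reg_pop e Di) (reg_push _ b Dj))) => // k _.
  by rewrite /upd ei (eq_sym j i) (negPf nij).
have ei' : upd (upd e i w) j (b :: e j) i = w.
  by rewrite /upd (negPf nij) eqxx.
have h2 := ih _ ei'.
apply: (reg_le (reg_ext (reg_whileS Di ei h1 h2) _ _)) => //; last lia.
move=> k _; rewrite /upd eqxx; case: (k =P i) => // _.
by case: eqP.
Qed.

Definition mvrev2 i j k :=
  While i (Seq (Pop i) (Seq (Push j false) (Push k false)))
    (Seq (Pop i) (Seq (Push j true) (Push k true))).

Lemma reg_mvrev2 (D : pred nat) i j k e : D i -> D j -> D k ->
  i != j -> i != k -> j != k ->
  reg D (mvrev2 i j k) e (8 * size (e i) + 1)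
    (upd (upd (upd e k (catrev (e i) (e k))) j (catrev (e i) (e j))) i [::]).
Proof.
move=> Di Dj Dk nij nik njk; move ei: (e i) => w.
elim: w e ei => [|b w ih] e ei /=.
  apply: (reg_ext (reg_while0 _ _ Di ei)) => // l _.
  by rewrite /upd; do 3 case: eqP => [->//|_].
set C := fun b => Seq (Pop i) (Seq (Push j b) (Push k b)).
have h1 : reg D (if b then C true else C false) e 6
    (upd (upd (upd e i w) j (b :: e j)) k (b :: e k)).
  have -> : (if b then C true else C false) = C b by case: b {ei}.
  apply: (reg_ext (reg_seq (reg_pop e Di)
    (reg_seq (reg_push _ b Dj) (reg_push _ b Dk)))) => // l _.
  rewrite /upd ei (eq_sym k i) (eq_sym k j) (eq_sym j i).
  by rewrite (negPf nij) (negPf njk) (negPf nik).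
have ei' : upd (upd (upd e i w) j (b :: e j)) k (b :: e k) i = w.
  by rewrite /upd (negPf nij) (negPf nik) eqxx.
have h2 := ih _ ei'.
apply: (reg_le (reg_ext (reg_whileS Di ei h1 h2) _ _)) => //; last lia.
move=> l _; rewrite /upd !eqxx ?(negPf njk) ?(negPf nij).
by case: (l =P i) => // _; case: (l =P j) => // _; case: (l =P k).
Qed.

(** Two reversals cancel; the second refills [i] while filling [j]. *)
Definition copy_word i j k := Seq (mvrev i k) (mvrev2 k i j).

Lemma reg_copy_word (D : pred nat) i j k e : D i -> D j -> D k ->
  i != j -> i != k -> j != k -> e j = [::] -> e k = [::] ->
  reg D (copy_word i j k) e (14 * size (e i) + 2) (upd e j (e i)).
Proof.
move=> Di Dj Dk nij nik njk ej ek.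
have h1 := @reg_mvrev D i k e Di Dk nik.
have nki : k != i by rewrite eq_sym.
have nkj : k != j by rewrite eq_sym.
have h2 := @reg_mvrev2 D k i j (upd (upd e k (catrev (e i) (e k))) i [::])
  Dk Di Dj nki nkj nij.
apply: (reg_le (reg_ext (reg_seq h1 h2) _ _)) => //.
  move=> l _; rewrite /upd !eqxx (negPf nki) (eq_sym j) (negPf nij) (negPf njk).
  rewrite ek ej -/(rev (e i)) -/(rev (rev (e i))) revK.
  by case: (l =P k) => [->|_]; rewrite ?(negPf nkj) ?ek //;
    case: (l =P i) => [->|_]; rewrite ?(negPf nij).
rewrite /upd eqxx (negPf nki) ek -/(rev (e i)) size_rev; lia.
Qed.

Definition mv_word i j k := Seq (mvrev i k) (mvrev k j).

Lemma reg_mv_word (D : pred nat) i j k e : D i -> D j -> D k ->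
  i != j -> i != k -> j != k -> e j = [::] -> e k = [::] ->
  reg D (mv_word i j k) e (12 * size (e i) + 2) (upd (upd e j (e i)) i [::]).
Proof.
move=> Di Dj Dk nij nik njk ej ek.
have h1 := @reg_mvrev D i k e Di Dk nik.
have nki : k != i by rewrite eq_sym.
have nkj : k != j by rewrite eq_sym.
have h2 := @reg_mvrev D k j (upd (upd e k (catrev (e i) (e k))) i [::]) Dk Dj nkj.
apply: (reg_le (reg_ext (reg_seq h1 h2) _ _)) => //.
  move=> l _; rewrite /upd !eqxx (negPf nki) (eq_sym j) (negPf nij) (negPf njk).
  rewrite ek ej -/(rev (e i)) -/(rev (rev (e i))) revK.
  case: (l =P k) => [->|_]; rewrite ?(negPf nkj) ?(negPf nki) ?ek //.
  by case: (l =P j) => [->|_] //; rewrite eq_sym (negPf nij).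
rewrite /upd eqxx (negPf nki) ek -/(rev (e i)) size_rev; lia.
Qed.

Definition clear_word i := While i (Pop i) (Pop i).

Lemma reg_clear_word (D : pred nat) i e : D i ->
  reg D (clear_word i) e (4 * size (e i) + 1) (upd e i [::]).
Proof.
move=> Di; move ei: (e i) => w; elim: w e ei => [|b w ih] e ei /=.
  apply: (reg_ext (reg_while0 _ _ Di ei)) => // k _.
  by rewrite /upd; case: eqP => [->//|_].
have h1 : reg D (if b then Pop i else Pop i) e 2 (upd e i w).
  by rewrite if_same; have := @reg_pop D e i Di; rewrite ei.
have h2 := ih (upd e i w) ltac:(by rewrite /upd eqxx).
apply: (reg_le (reg_ext (reg_whileS Di ei h1 h2) _ _)) => //; last lia.
by move=> k _; rewrite /upd; case: (k =P i).
Qed.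

End Reg.

(** * Polynomial-time stack programs *)

Section PolyBounds.

Definition tot (xs : seq word) := sumn (map size xs).

Lemma tot_cat xs ys : tot (xs ++ ys) = tot xs + tot ys.
Proof. by rewrite /tot map_cat sumn_cat. Qed.

Lemma size_nth_tot xs i : size (nth [::] xs i) <= tot xs.
Proof.
elim: xs i => [|x xs ih] [|i] //=; rewrite /tot /= ?leq_addr //.
exact: leq_trans (ih i) (leq_addl _ _).
Qed.

Lemma tot_take i xs : tot (take i xs) <= tot xs.
Proof. by rewrite -[in X in _ <= X](cat_take_drop i xs) tot_cat leq_addr. Qed.

Lemma tot_drop i xs : tot (drop i xs) <= tot xs.
Proof. by rewrite -[in X in _ <= X](cat_take_drop i xs) tot_cat leq_addl. Qed.

(** The base is at least 2, so a single power absorbs constants, sums and products. *)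
Definition pb n (h : seq word -> nat) :=
  exists k, forall xs, size xs = n -> h xs <= (tot xs + 2) ^ k.

Lemma pb_le n h h' : pb n h' -> (forall xs, size xs = n -> h xs <= h' xs) ->
  pb n h.
Proof.
by case=> k hk le; exists k => xs hxs; apply: leq_trans (le _ hxs) (hk _ hxs).
Qed.

Lemma pb_const n c : pb n (fun=> c).
Proof.
exists c => xs _; apply: leq_trans (ltnW (ltn_expl c (isT : 1 < 2))) _.
by case: c => // c; rewrite leq_exp2r ?leq_addl.
Qed.

Lemma pb_tot n : pb n tot.
Proof. by exists 1 => xs _; rewrite expn1 leq_addr. Qed.

Lemma pb_mul n h h' : pb n h -> pb n h' -> pb n (fun xs => h xs * h' xs).
Proof.
by case=> k hk [l hl]; exists (k + l) => xs e; rewrite expnD leq_mul ?hk ?hl.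
Qed.

Lemma pb_add n h h' : pb n h -> pb n h' -> pb n (fun xs => h xs + h' xs).
Proof.
case=> k hk [l hl]; exists (k + l).+1 => xs e.
have := hk xs e; have := hl xs e.
rewrite expnS expnD; set a := _ ^ k; set b := _ ^ l.
have : 0 < a by rewrite expn_gt0 addn2.
have : 0 < b by rewrite expn_gt0 addn2.
nia.
Qed.

Lemma pb_exp n h k : pb n h -> pb n (fun xs => h xs ^ k).
Proof.
move=> hh; elim: k => [|k ih]; first exact: pb_const.
by apply: (pb_le (pb_mul hh ih)) => xs _; rewrite expnS.
Qed.

Lemma pb_comp n m F h : (forall xs, size xs = n -> size (F xs) = m) ->
  pb m h -> pb n (fun xs => tot (F xs)) -> pb n (fun xs => h (F xs)).
Proof.
move=> hF [k hk] ht.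
apply: (@pb_le n _ (fun xs => (tot (F xs) + 2) ^ k)).
  by apply: pb_exp; apply: pb_add => //; exact: pb_const.
by move=> xs e; apply: hk; exact: hF.
Qed.

End PolyBounds.

Lemma map_nth_all n (xs : seq word) : size xs = n ->
  [seq nth [::] xs i | i <- iota 0 n] = xs.
Proof. by move=> <-; rewrite (@map_nth_iota0 _ [::]) ?take_size. Qed.

Section Programs.
Variable g : word -> word.

(* [F] acts on stacks of [n] words, stored in the tapes [0, ..., n - 1].  The
   scratch tapes, up to [N], are blank before and after, so that such programs
   can be iterated.  [F] may change the height of the stack. *)
Definition st n (F : seq word -> seq word) := exists c N h,
  [/\ pb n h, n <= N & forall xs, size xs = n ->
  [/\ size (F xs) <= N, tot (F xs) <= h xs &
      reg g (fun i => i < N) c (nth [::] xs) (h xs) (nth [::] (F xs))]].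

Definition fp n (f : seq word -> word) := st n (fun xs => [:: f xs]).

Lemma st_ext n F G : st n F -> (forall xs, size xs = n -> F xs = G xs) ->
  st n G.
Proof.
move=> [c [N [h [hh hN hc]]]] e; exists c, N, h; split=> // xs hxs.
by rewrite -e //; exact: hc.
Qed.

Lemma fp_ext n f f' : fp n f -> (forall xs, size xs = n -> f xs = f' xs) ->
  fp n f'.
Proof. by move=> hf e; apply: (st_ext hf) => xs h; rewrite e. Qed.

Lemma st_tot n F : st n F -> pb n (fun xs => tot (F xs)).
Proof.
by case=> [c [N [h [hh hN hc]]]]; apply: (pb_le hh) => xs /hc[].
Qed.

Lemma reg_widen N N' c xs ys t : N <= N' -> size xs <= N -> size ys <= N ->
  reg g (fun i => i < N) c (nth [::] xs) t (nth [::] ys) ->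
  reg g (fun i => i < N') c (nth [::] xs) t (nth [::] ys).
Proof.
move=> hN hx hy hr; apply: (reg_sub hr) => i /=; first by move=> h; lia.
by move=> _; rewrite -leqNgt => h; rewrite !nth_default //; lia.
Qed.

Lemma st_comp n m F G : st n F -> st m G ->
  (forall xs, size xs = n -> size (F xs) = m) -> st n (fun xs => G (F xs)).
Proof.
move=> sF [c' [N' [h' [hh' hN' hc']]]] e.
have tF := st_tot sF; case: sF => [c [N [h [hh hN hc]]]].
exists (Seq c c'), (maxn N N'), (fun xs => h xs + h' (F xs)); split.
- exact: (pb_add hh (pb_comp e hh' tF)).
- by rewrite leq_max hN.
move=> xs hxs; have [h1 h2 h3] := hc _ hxs.
have [h1' h2' h3'] := hc' _ (e _ hxs); split.
- by rewrite leq_max h1' orbT.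
- exact: leq_trans h2' (leq_addl _ _).
apply: (@reg_seq _ _ _ _ _ _ (nth [::] (F xs))).
  by apply: (reg_widen _ _ _ h3); rewrite ?leq_maxl ?hxs.
by apply: (reg_widen _ _ _ h3'); rewrite ?leq_maxr ?e.
Qed.

Lemma st_id n : st n id.
Proof.
exists Skip, n, tot; split=> //; first exact: pb_tot.
move=> xs hxs; split; rewrite ?hxs //.
exact: reg_le (reg_skip _ _ _) _.
Qed.

Lemma st_frame a n F : st n F ->
  st (a + n) (fun xs => take a xs ++ F (drop a xs)).
Proof.
case=> [c [N [h [hh hN hc]]]].
exists (shift_cmd a c), (a + N), (fun xs => tot xs + h (drop a xs)); split.
- apply: pb_add; first exact: pb_tot.
  apply: (pb_comp _ hh); first by move=> xs hxs; rewrite size_drop hxs addKn.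
  by apply: (pb_le (pb_tot _)) => xs _; exact: tot_drop.
- by rewrite leq_add2l.
move=> xs hxs; have /hc[h1 h2 h3] : size (drop a xs) = n.
  by rewrite size_drop hxs addKn.
have sa : size (take a xs) = a by rewrite size_takel // hxs leq_addr.
split.
- by rewrite size_cat sa leq_add2l.
- by rewrite tot_cat leq_add ?tot_take.
apply: (@reg_le _ _ _ _ (h (drop a xs))); last exact: leq_addl.
pose e ys j := if j < a then nth [::] xs j else nth [::] ys (j - a).
apply: (reg_ext (reg_sub (reg_ext (f := e (drop a xs)) (f' := e (F (drop a xs)))
  (reg_shift a h3) _ _) _ _)); rewrite /e.
- by move=> j /andP[]; rewrite leqNgt => /negPf ->.
- by move=> j /andP[]; rewrite leqNgt => /negPf ->.
- by move=> j /= /andP[]; lia.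
- by move=> j /= hj nD; case: (ltnP j a) => // h'; exfalso; lia.
- by move=> j _; case: ltnP => // h'; rewrite nth_drop subnKC.
move=> j _; rewrite nth_cat sa; case: ltnP => // h'; by rewrite nth_take.
Qed.

Lemma st_copy n i : i < n -> st n (fun xs => rcons xs (nth [::] xs i)).
Proof.
move=> hi.
exists (copy_word i n n.+1), n.+2, (fun xs => 14 * tot xs + 2); split.
- apply: pb_add; last exact: pb_const.
  by apply: pb_mul; [exact: pb_const | exact: pb_tot].
- lia.
move=> xs hxs; have := size_nth_tot xs i => hs; split.
- by rewrite size_rcons hxs.
- rewrite -cats1 tot_cat /tot /= -/(tot xs); lia.
apply: (@reg_le _ _ _ _ (14 * size (nth [::] xs i) + 2)); last lia.
apply: (reg_ext (@reg_copy_word g _ i n n.+1 (nth [::] xs) _ _ _ _ _ _ _ _)) => //;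
  try lia; try by rewrite nth_default ?hxs.
move=> j hj; rewrite /upd nth_rcons hxs; case: eqP => [->|ne].
  by rewrite ltnn.
by case: ltnP => // h; rewrite nth_default ?hxs.
Qed.

(** The words sit in fixed tapes, so dropping the first one means moving every other word down by
    one tape. *)
Lemma st_behead n : st n behead.
Proof.
case: n => [|n].
  by apply: (st_ext (st_id 0)) => xs /size0nil ->.
pose mv k := foldr (fun j c => Seq (mv_word j.+1 j n.+1) c) Skip (iota k (n - k)).
exists (Seq (clear_word 0) (mv 0)), n.+2, (fun xs => 12 * tot xs + 2 * n + 2); split.
- do 2 (apply: pb_add; last exact: pb_const).
  by apply: pb_mul; [exact: pb_const | exact: pb_tot].
- lia.
case=> // x xs [hxs]; split.
- by rewrite /= hxs; lia.
- by rewrite /tot /=; lia.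
(* The contents after [k] moves: tape [k] is the hole. *)
pose e k j := if j < k then nth [::] xs j else if j == k then [::] else
  nth [::] (x :: xs) j.
have hmv m k : m + k = n -> reg g (fun i => i < n.+2) (mv k) (e k)
    (12 * tot (drop k xs) + 2 * m) (e n).
  elim: m k => [|m ih] k hk.
    have -> : k = n by lia.
    rewrite /mv subnn.
    by apply: reg_le (reg_skip _ _ _) _.
  have -> : mv k = Seq (mv_word k.+1 k n.+1) (mv k.+1).
    by rewrite /mv (_ : n - k = (n - k.+1).+1) //; lia.
  have lt_k : k < size xs by lia.
  have hk' : m + k.+1 = n by lia.
  have hmv : reg g (fun i => i < n.+2) (mv_word k.+1 k n.+1) (e k)
      (12 * size (nth [::] xs k) + 2) (e k.+1).
    have ek : e k k.+1 = nth [::] xs k.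
      by rewrite /e ltnNge leqnSn /= (gtn_eqF (ltnSn k)).
    rewrite -ek.
    apply: (reg_ext (@reg_mv_word g _ k.+1 k n.+1 (e k) _ _ _ _ _ _ _ _)
      (fun=> fun=> erefl)); try lia.
    - by rewrite /e ltnn eqxx.
    - rewrite /e; case: ltnP; first lia; case: eqP => // _ _.
      by rewrite nth_default //= hxs.
    - move=> i hi; rewrite /upd ek /e.
      case: (i =P k.+1) => [->|ne]; first by rewrite ltnn.
      case: (i =P k) => [->|ne']; first by rewrite ltnSn.
      by have -> : (i < k.+1) = (i < k) by lia.
  apply: (reg_le (reg_seq hmv (ih _ hk'))).
  by rewrite (drop_nth [::] lt_k) /tot /= -/(tot _); lia.
apply: (reg_le (reg_seq
  (reg_ext (@reg_clear_word g _ 0 (nth [::] (x :: xs)) _) (fun=> fun=> erefl) _)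
  (reg_ext (hmv n 0 (addn0 n)) (fun=> fun=> erefl) _))) => //.
- move=> i hi; rewrite /e /=; case: ltnP => // h; rewrite [RHS]nth_default ?hxs //.
  by case: eqP => // ne; rewrite nth_default //= hxs; lia.
by rewrite drop0 /tot /= -/(tot xs); lia.
Qed.

Lemma st_drop n m : st n (drop m).
Proof.
elim: m n => [|m ih] n.
  by apply: (st_ext (st_id n)) => xs _; rewrite drop0.
apply: (st_ext (st_comp (st_behead n) (ih n.-1) _)).
  by move=> xs <-; rewrite size_behead.
by move=> [|x xs].
Qed.

Lemma st_copies n s : all (fun i => i < n) s ->
  st n (fun xs => xs ++ [seq nth [::] xs i | i <- s]).
Proof.
elim/last_ind: s => [|s i ih].
  by move=> _; apply: (st_ext (st_id n)) => xs _; rewrite cats0.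
rewrite all_rcons => /andP[hi hs].
apply: (st_ext (st_comp (ih hs) (@st_copy (n + size s) i _) _)).
- by rewrite ltn_addr.
- by move=> xs hxs; rewrite size_cat size_map hxs.
by move=> xs hxs; rewrite nth_cat hxs hi map_rcons rcons_cat.
Qed.

Lemma st_sel n s : all (fun i => i < n) s ->
  st n (fun xs => [seq nth [::] xs i | i <- s]).
Proof.
move=> hs; apply: (st_ext (st_comp (st_copies hs) (st_drop (n + size s) n) _)).
  by move=> xs hxs; rewrite size_cat size_map hxs.
by move=> xs hxs; rewrite drop_size_cat.
Qed.

Lemma fp_var n i : i < n -> fp n (fun xs => nth [::] xs i).
Proof. by move=> h; apply: (@st_sel n [:: i]); rewrite /= h. Qed.

Lemma st_nil n : st n (fun=> [::]).
Proof. exact: (@st_sel n [::]). Qed.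

(** The stack is duplicated, [f] runs on the upper copy by [st_frame], its value is rotated to the
    front, and [F] runs on the remaining original, again by [st_frame]. *)
Lemma st_cons n f F : fp n f -> st n F -> st n (fun xs => f xs :: F xs).
Proof.
move=> hf hF; have hio : all (fun i => i < n) (iota 0 n).
  by apply/allP => i; rewrite mem_iota.
have dup : st n (fun xs => xs ++ xs).
  apply: (st_ext (st_copies hio)) => xs hxs.
  by rewrite map_nth_all.
have s1 : st n (fun xs => rcons xs (f xs)).
  apply: (st_ext (st_comp dup (st_frame n hf) _)).
    by move=> xs hxs; rewrite size_cat hxs.
  by move=> xs hxs; rewrite take_size_cat // drop_size_cat // cats1.
have hro : all (fun i => i < n.+1) (n :: iota 0 n).
  by rewrite /= ltnSn; apply/allP => i; rewrite mem_iota /=; lia.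
have s2 : st n (fun xs => f xs :: xs).
  apply: (st_ext (st_comp s1 (st_sel hro) _)).
    by move=> xs hxs; rewrite size_rcons hxs.
  move=> xs hxs; rewrite /= nth_rcons hxs ltnn eqxx; congr cons.
  rewrite -[RHS](map_nth_all hxs).
  by apply/eq_in_map => i; rewrite mem_iota /= nth_rcons hxs => ->.
apply: (st_ext (st_comp s2 (st_frame 1 hF) _)).
  by move=> xs hxs; rewrite /= hxs.
by move=> xs _; rewrite /= take0 drop0.
Qed.

Lemma fp_comp n k F f : st n F -> fp k f ->
  (forall xs, size xs = n -> size (F xs) = k) -> fp n (fun xs => f (F xs)).
Proof. exact: (@st_comp n k F (fun ys => [:: f ys])). Qed.

Lemma fp_nil n : fp n (fun=> [::]).
Proof.
apply: (@st_comp n 0 (fun=> [::]) (fun=> [:: [::]]) (st_nil n)) => //.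
exists Skip, 1, (fun=> 0); split=> //; first exact: pb_const.
case=> // _; split=> //; apply: (reg_ext (reg_skip _ _ _)) => //.
by case=> // i; rewrite /= nth_nil.
Qed.

Lemma fp_push b : fp 1 (fun xs => b :: nth [::] xs 0).
Proof.
exists (Push 0 b), 1, (fun xs => tot xs + 2); split=> //.
  by apply: pb_add; [exact: pb_tot | exact: pb_const].
case=> // x [|//] _; split=> //; first by rewrite /tot /=; lia.
apply: (@reg_le _ _ _ _ 2); last exact: leq_addl.
apply: (reg_ext (@reg_push g (fun i => i < 1) (nth [::] [:: x]) 0 b isT)) => //.
by case.
Qed.

Lemma fp_pop : fp 1 (fun xs => behead (nth [::] xs 0)).
Proof.
exists (Pop 0), 1, (fun xs => tot xs + 2); split=> //.
  by apply: pb_add; [exact: pb_tot | exact: pb_const].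
case=> // x [|//] _; split=> //; first by rewrite /tot /= size_behead; lia.
apply: (@reg_le _ _ _ _ 2); last exact: leq_addl.
apply: (reg_ext (@reg_pop g (fun i => i < 1) (nth [::] [:: x]) 0 isT)) => //.
by case.
Qed.

Lemma fp_app1 n f a : fp 1 (fun xs => f (nth [::] xs 0)) -> fp n a ->
  fp n (fun xs => f (a xs)).
Proof.
by move=> hf ha; apply: (@fp_comp n 1 (fun xs => [:: a xs]) _ ha hf).
Qed.

Lemma fp_cons n b f : fp n f -> fp n (fun xs => b :: f xs).
Proof. exact: (@fp_app1 n (cons b) f (fp_push b)). Qed.

Lemma fp_behead n f : fp n f -> fp n (fun xs => behead (f xs)).
Proof. exact: (@fp_app1 n behead f fp_pop). Qed.

Lemma fp_const n w : fp n (fun=> w).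
Proof. by elim: w => [|b w ih]; [exact: fp_nil | exact: fp_cons]. Qed.

Lemma st_case n i F0 F1 : i < n -> st n F0 -> st n F1 ->
  st n (fun xs => if head false (nth [::] xs i) then F1 xs else F0 xs).
Proof.
move=> hi [c0 [N0 [h0 [hh0 hN0 hc0]]]] [c1 [N1 [h1 [hh1 hN1 hc1]]]].
exists (If i c0 c1), (maxn N0 N1), (fun xs => (h0 xs + h1 xs) + 2); split.
- exact: (pb_add (pb_add hh0 hh1) (pb_const n 2)).
- by rewrite leq_max hN0.
move=> xs hxs; have [h11 h12 h13] := hc1 _ hxs; have [h01 h02 h03] := hc0 _ hxs.
split.
- by case: ifP => _; rewrite leq_max ?h11 ?h01 ?orbT.
- by case: ifP => _; lia.
apply: (@reg_le _ _ _ _ (h0 xs + h1 xs).+2); last lia.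
apply: reg_if; first by rewrite leq_max (leq_trans hi hN0).
case: ifP => _.
  apply: reg_le (leq_addl _ _).
  by apply: (reg_widen _ _ _ h13); rewrite ?leq_maxr ?hxs.
apply: reg_le (leq_addr _ _).
by apply: (reg_widen _ _ _ h03); rewrite ?leq_maxl ?hxs.
Qed.

Lemma st_if n c F0 F1 : fp n c -> st n F1 -> st n F0 ->
  st n (fun xs => if head false (c xs) then F1 xs else F0 xs).
Proof.
move=> hc h1 h0.
have s1 : st n (fun xs => c xs :: xs) by apply: st_cons => //; exact: st_id.
have sb F : st n F -> st n.+1 (fun xs => F (behead xs)).
  move=> hF; apply: (st_comp (st_behead n.+1) hF) => xs.
  by rewrite size_behead => ->.
apply: (st_ext (st_comp s1 (@st_case n.+1 0 _ _ isT (sb _ h0) (sb _ h1)) _)) => //.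
by move=> xs /= ->.
Qed.

Lemma fp_if n c f0 f1 : fp n c -> fp n f1 -> fp n f0 ->
  fp n (fun xs => if head false (c xs) then f1 xs else f0 xs).
Proof.
by move=> hc h1 h0; apply: (st_ext (st_if hc h1 h0)) => xs _; case: ifP.
Qed.

(** A loop controlled by the first word, which the passes consume but cannot extend; the number of
    passes is therefore at most the input size. *)
Definition iter_word (F : bool -> seq word -> seq word) (xs : seq word) :=
  foldl (fun ys b => F b ys) (behead xs) (head [::] xs).

(** Polynomial time of each pass would still allow exponential growth, so a bound on the iterates is
    a hypothesis. Applied to the prefixes of the control word, it covers all intermediate stacks. *)
Lemma st_loop n F B : (forall b, st n (F b)) ->
  (forall b ys, size ys = n -> size (F b ys) = n) ->
  pb n.+1 B ->
  (forall a ys, size ys = n -> tot (iter_word F (a :: ys)) <= B (a :: ys)) ->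
  st n.+1 (iter_word F).
Proof.
move=> sF zF [l hl] hB.
have zI a ys : size ys = n -> size (iter_word F (a :: ys)) = n.
  by rewrite /iter_word /=; elim: a ys => //= b a ih ys e; rewrite ih ?zF.
(* The loop leaves its exhausted control word in tape 0; [st_behead] removes it. *)
suff H : st n.+1 (fun xs => [::] :: iter_word F xs).
  apply: (st_ext (st_comp H (st_behead n.+1) _)) => //.
  by move=> [|x xs] //= [hxs]; rewrite zI.
have [c0 [N0 [h0 [[k0 hh0] hN0 hc0]]]] := sF false.
have [c1 [N1 [h1 [[k1 hh1] hN1 hc1]]]] := sF true.
pose N := maxn N0 N1.
pose S xs := (tot xs + 2) ^ l.
pose T xs := (S xs + 2) ^ k0 + (S xs + 2) ^ k1.
exists (While 0 (Seq (Pop 0) (shift_cmd 1 c0)) (Seq (Pop 0) (shift_cmd 1 c1))), N.+1.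
exists (fun xs => tot xs * (T xs + 4) + S xs + 1).
have pS : pb n.+1 S by exists l.
have pT : pb n.+1 T.
  by apply: pb_add; apply: pb_exp; apply: pb_add => //; exact: pb_const.
split.
- apply: pb_add; last exact: pb_const; apply: pb_add => //.
  apply: pb_mul; first exact: pb_tot.
  by apply: pb_add => //; exact: pb_const.
- by rewrite ltnS leq_max hN0.
case=> // a ys [hys]; split.
- by rewrite /= zI // ltnS leq_max hN0.
- rewrite /tot /= add0n -/(tot _).
  have := hl (a :: ys); rewrite /= hys => /(_ erefl) => h.
  by apply: leq_trans (hB _ _ hys) _; rewrite /S; lia.
(* [B] need not be monotone; its majorant [S] is, which transfers the bound from a prefix to the
   whole input. *)
have small a' : size a' <= size a -> tot (iter_word F (a' :: ys)) <= S (a :: ys).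
  move=> le; apply: leq_trans (hB _ _ hys) _.
  apply: leq_trans (hl _ _) _; first by rewrite /= hys.
  rewrite /S; case: (l) => // l'; rewrite leq_exp2r // leq_add2r /tot /=.
  by rewrite leq_add2r.
have {hB hl} small j : tot (iter_word F (take j a :: ys)) <= S (a :: ys).
  by apply: small; rewrite size_take_min geq_minr.
have body b w zs : size zs = n -> tot zs <= S (a :: ys) ->
    reg g (fun i => i < N.+1) (if b then Seq (Pop 0) (shift_cmd 1 c1) else
       Seq (Pop 0) (shift_cmd 1 c0))
      (nth [::] ((b :: w) :: zs)) (T (a :: ys) + 2) (nth [::] (w :: F b zs)).
  move=> hzs hs.
  pose c := if b then c1 else c0; pose Nb := if b then N1 else N0.
  have hNb : Nb <= N by rewrite /Nb /N; case: (b); rewrite ?leq_maxr ?leq_maxl.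
  have -> : (if b then Seq (Pop 0) (shift_cmd 1 c1) else Seq (Pop 0) (shift_cmd 1 c0))
    = Seq (Pop 0) (shift_cmd 1 c) by rewrite /c; case: (b).
  have [hz hz' hr] : [/\ n <= Nb, size (F b zs) <= Nb &
     reg g (fun i => i < Nb) c (nth [::] zs) (T (a :: ys)) (nth [::] (F b zs))].
    have mono k : (tot zs + 2) ^ k <= (S (a :: ys) + 2) ^ k.
      by case: k => // k; rewrite leq_exp2r // leq_add2r.
    rewrite /c /Nb; case: (b).
      have [e1 _ e3] := hc1 _ hzs; split=> //; apply: (reg_le e3).
      by apply: leq_trans (hh1 _ hzs) (leq_trans (mono _) (leq_addl _ _)).
    have [e1 _ e3] := hc0 _ hzs; split=> //; apply: (reg_le e3).
    by apply: leq_trans (hh0 _ hzs) (leq_trans (mono _) (leq_addr _ _)).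
  rewrite addnC.
  have hp : reg g (fun i => i < N.+1) (Pop 0) (nth [::] ((b :: w) :: zs)) 2
      (nth [::] (w :: zs)).
    apply: (reg_ext
      (@reg_pop g (fun i => i < N.+1) (nth [::] ((b :: w) :: zs)) 0 isT)) => //.
    by case.
  apply: (reg_seq hp).
  apply: (reg_ext (reg_sub (reg_ext (reg_shift 1 hr) (f := nth [::] (w :: zs))
    (f' := nth [::] (w :: F b zs)) _ _) _ _)) => //.
  - by move=> [|i] // _; rewrite subn1.
  - by move=> [|i] // _; rewrite subn1.
  - by move=> [|i] //=; rewrite subn1 /=; lia.
  move=> [|i] //=; rewrite subn1 /= => _; rewrite -leqNgt => h.
  by rewrite !nth_default ?(leq_trans hz' h) // hzs (leq_trans hz h).
(* Loop invariant: [take j a] has been consumed and [w] is left. *)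
have H w j : a = take j a ++ w -> size (take j a) = j ->
  reg g (fun i => i < N.+1)
   (While 0 (Seq (Pop 0) (shift_cmd 1 c0)) (Seq (Pop 0) (shift_cmd 1 c1)))
   (nth [::] (w :: iter_word F (take j a :: ys))) (size w * (T (a :: ys) + 4) + 1)
   (nth [::] ([::] :: iter_word F (a :: ys))).
  elim: w j => [|b w ih] j ha hj.
    rewrite cats0 in ha; rewrite -ha /=.
    exact: reg_while0.
  have ej : take j.+1 a = rcons (take j a) b.
    rewrite {1}ha take_cat hj ltnNge leqnSn /= subSn // subnn /= take0.
    by rewrite cats1.
  have Ij : iter_word F (take j.+1 a :: ys) = F b (iter_word F (take j a :: ys)).
    by rewrite /iter_word /= ej foldl_rcons.
  have := ih j.+1; rewrite Ij ej cat_rcons -ha size_rcons hj => /(_ erefl erefl) h.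
  apply: (reg_le (reg_whileS _ (b := b) (w := w) _ (body b w _ _ (small j)) h)) => //=.
    exact: zI.
  by rewrite mulSn; lia.
have := H a 0; rewrite take0 => /(_ erefl erefl) h.
apply: (reg_le h); have le_a : size a <= tot (a :: ys) by exact: leq_addr.
by rewrite -addnA leq_add ?leq_mul // addn1.
Qed.

End Programs.

(** * Polynomials against powers of [m + 2] *)

Section Horner.

Lemma horner_nat_bound (p : {poly nat}) : exists k, forall m : nat,
  horner p m <= (m + 2) ^ k.
Proof.
rewrite /horner; elim: (polyseq p) => [|a s [k ih]]; first by exists 0.
exists (k + 1 + a).+1 => m /=.
have h1 : a <= (m + 2) ^ a.
  apply: leq_trans (ltnW (ltn_expl a (isT : 1 < 2))) _.
  by case: (a) => // b; rewrite leq_exp2r ?leq_addl.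
have h2 : 0 < (m + 2) ^ a by rewrite expn_gt0 addn2.
have h3 : 0 < (m + 2) ^ k by rewrite expn_gt0 addn2.
have h4 := ih m; set r := horner_rec s m in h4 *.
rewrite -[(_ * _)%R]/(r * m) -[(_ + _)%R]/(r * m + a).
rewrite expnS !expnD expn1.
set A := (m + 2) ^ a in h1 h2 *; set K := (m + 2) ^ k in h3 h4 *.
move: r A K h1 h2 h3 h4 => r A K h1 h2 h3 h4.
have h5 : A <= K * (m + 2) * A by rewrite leq_pmull // muln_gt0 h3 addn2.
have h6 : r * m <= K * (m + 2) * A.
  by rewrite -[r * m]muln1 !leq_mul // leq_addr.
rewrite mulnDl mul2n -addnn; apply: leq_trans (leq_addl _ _).
by rewrite leq_add // (leq_trans h1).
Qed.

Lemma horner_exp_nat k m :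
  (horner (('X + polyC 2) ^+ k : {poly nat}) m)%R = (m + 2) ^ k.
Proof.
by rewrite horner_exp hornerD hornerX hornerC -natr1E.
Qed.

End Horner.

(** * Calls of given machines *)

Section Stages.
Variable g : word -> word.

(* Unlike [st], this covers calls of arbitrary machines, which leave garbage
   that cannot be located: the tapes [P, ..., P' - 1] are abandoned. *)
Definition dst n (F : seq word -> seq word) := exists N0, forall N P,
  N0 <= N -> N <= P -> exists c P' h,
  [/\ pb n h, P <= P' & forall xs, size xs = n -> tot (F xs) <= h xs /\
  forall T, (forall i, i < N -> holds (T i) (nth [::] xs i)) ->
  (forall i, P <= i -> holds (T i) [::]) ->
  exists t T', [/\ t <= h xs, exec g c T t T',
    forall i, i < N -> holds (T' i) (nth [::] (F xs) i) &
    forall i, P' <= i -> holds (T' i) [::]]].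

Lemma dst_st n F : st g n F -> dst n F.
Proof.
case=> c [N0 [h [hh hN0 hc]]]; exists N0 => N P h1 h2.
exists c, P, h; split=> // xs hxs; have [e1 e2 e3] := hc _ hxs; split=> //.
move=> T hT hP.
have [i hi|t [T' [k1 k2 k3 k4]]] := @regP _ _ _ _ _ _ e3 T.
  by apply: hT; exact: leq_trans h1.
exists t, T'; split=> // i hi.
  have [/k3 //|le] := ltnP i N0; rewrite k4 -?leqNgt // nth_default ?(leq_trans e1) //.
  by have := hT i hi; rewrite nth_default // hxs (leq_trans hN0).
by rewrite k4; [exact: hP | rewrite -leqNgt; lia].
Qed.

Lemma dst_comp n m F G : dst n F -> dst m G ->
  (forall xs, size xs = n -> size (F xs) = m) -> dst n (fun xs => G (F xs)).
Proof.
move=> [N1 hF] [N2 hG] e; exists (maxn N1 N2) => N P.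
rewrite geq_max => /andP[h1 h2] hP.
have [c [P' [h [hh hP' hc]]]] := hF N P h1 hP.
have [c' [P'' [h' [hh' hP'' hc']]]] := hG N P' h2 (leq_trans hP hP').
exists (Seq c c'), P'', (fun xs => h xs + h' (F xs)); split.
- apply: (pb_add hh (pb_comp e hh' _)); apply: (pb_le hh) => xs hxs.
  by case: (hc _ hxs).
- exact: leq_trans hP''.
move=> xs hxs; have [a1 a2] := hc _ hxs; have [b1 b2] := hc' _ (e _ hxs).
split; first exact: leq_trans b1 (leq_addl _ _).
move=> T hT hTP; have [t [T' [k1 k2 k3 k4]]] := a2 T hT hTP.
have [t' [T'' [l1 l2 l3 l4]]] := b2 T' k3 k4.
exists (t + t'), T''; split=> //; first exact: leq_add.
exact: exec_seq k2 l2.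
Qed.

(** [reg_mvrev] does not apply, as nothing is known about tape [P] beyond its leading word. The
    reversed word goes to a clean tape. *)
Lemma exec_unload P k : P != k -> forall w T v,
  word_of_tape (T P) = w -> holds (T k) v -> exists T',
  [/\ exec g (mvrev P k) T (6 * size w + 1) T', holds (T' k) (catrev w v) &
      forall l, l != P -> l != k -> T' l = T l].
Proof.
move=> nPk; elim=> [|b w ih] T v hw hv.
  exists T; split=> //; apply: exec_while_stop.
  by rewrite read_word_of_tape hw.
pose T1 := set_tape T P (tape_pop (T P)).
pose T2 := set_tape T1 k (tape_push b (T1 k)).
have e1 : exec g (Seq (Pop P) (Push k b)) T 4 T2.
  exact: exec_seq (exec_pop _ _ _) (exec_push _ _ _ _).
have T2P : T2 P = tape_pop (T P).
  by rewrite /T2 /set_tape (negPf nPk) /T1 /set_tape eqxx.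
have T2k : T2 k = tape_push b (T k).
  by rewrite /T2 /T1 /set_tape eqxx eq_sym (negPf nPk).
have [||T' [k1 k2 k3]] := ih T2 (b :: v).
- by rewrite T2P; exact: word_of_tape_pop hw.
- by rewrite T2k; exact: holds_push.
exists T'; split=> //.
  have -> : 6 * size (b :: w) + 1 = 4.+2 + (6 * size w + 1) by rewrite /=; lia.
  apply: (@exec_while_go _ _ _ _ b _ _ T2) k1.
    by rewrite read_word_of_tape hw.
  suff -> : (if b then Seq (Pop P) (Push k true) else Seq (Pop P) (Push k false))
    = Seq (Pop P) (Push k b) by [].
  by case: (b).
move=> l lP lk; rewrite k3 // /T2 /T1 /set_tape.
by rewrite (negPf lP) (negPf lk).
Qed.

(** The arguments are copied to the tapes [P] and [P.+1], the machine runs moved up by [P], and two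
    reversals bring its output to tape [n]. *)
Lemma dst_call n (f : 2.-tuple word -> word) i j : in_pg g f ->
  i < n -> j < n ->
  dst n (fun xs => rcons xs (f [tuple nth [::] xs i; nth [::] xs j])).
Proof.
move=> [M [p hM]] hi hj; exists n.+2 => N P hN hP.
have [kp hkp] := horner_nat_bound p.
(* The 2 covers both argument tapes even if the machine changes fewer; from [P'] on everything is
   still blank. *)
pose P' := P + maxn 2 (tape_bound M).
pose tm xs := (2 * tot xs + 2) ^ kp.
exists (Seq (copy_word i P n) (Seq (copy_word j P.+1 n) (Seq (shift_cmd P (Raw M))
  (Seq (mvrev P n.+1) (mvrev n.+1 n))))), P',
  (fun xs => 14 * tot xs + 2 + (14 * tot xs + 2 + (tm xs +
     (6 * (2 * tot xs + tm xs) + 1 + (6 * (2 * tot xs + tm xs) + 1))))).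
have ptm : pb n tm.
  apply: pb_exp; apply: pb_add; last exact: pb_const.
  by apply: pb_mul; [exact: pb_const | exact: pb_tot].
split; last 2 first.
- exact: leq_addr.
- move=> xs hxs.
  set x := nth [::] xs i; set y := nth [::] xs j.
  have hx : size x <= tot xs := size_nth_tot xs i.
  have hy : size y <= tot xs := size_nth_tot xs j.
  have [t [z [hrun ht hz]]] := hM [tuple x; y].
  have {}ht : t <= tm xs.
    apply: leq_trans ht (leq_trans (hkp _) _); rewrite /tm /=.
    by case: (kp) => // k; rewrite leq_exp2r //; lia.
  have hfx : size (f [tuple x; y]) <= 2 * tot xs + tm xs.
    rewrite -hz; apply: leq_trans (size_word_of_tape _) _.
    apply: leq_trans (leq_add (leqnn _) ht).
    apply: (runs_size hrun) => k /=; rewrite size_map.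
    by case: k => [|[|k]] /=; rewrite ?nth_nil //=; lia.
  have tot1 w : tot [:: w] = size w by exact: addn0.
  have bound a b c : c <= 2 * a + b ->
    a + c <= 14 * a + 2 + (14 * a + 2 + (b + (6 * (2 * a + b) + 1 +
      (6 * (2 * a + b) + 1)))) by lia.
  split; first by rewrite -cats1 tot_cat tot1; exact: bound.
  move=> T hT hTP.
  (* The garbage of earlier calls lies between [N] and [P] and is left out. *)
  pose D k := (k < N) || (P <= k).
  have hTD k : D k -> holds (T k) (nth [::] xs k).
    have [/hT //|le /=] := ltnP k N; rewrite /D ltnNge le /=.
    by rewrite nth_default ?hxs; [exact: hTP | lia].
  have DN k : k < N -> D k by rewrite /D => ->.
  have DP k : P <= k -> D k by rewrite /D => ->; rewrite orbT.
  have nilP k : n <= k -> nth [::] xs k = [::] by rewrite -hxs; exact: nth_default.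
  have h1 : reg g D (copy_word i P n) (nth [::] xs) (14 * size x + 2)
      (upd (nth [::] xs) P x).
    by apply: reg_copy_word; [apply: DN | apply: DP | apply: DN | | | |
      apply: nilP | apply: nilP]; lia.
  have h2 : reg g D (copy_word j P.+1 n) (upd (nth [::] xs) P x)
      (14 * size y + 2) (upd (upd (nth [::] xs) P x) P.+1 y).
    have ej : upd (nth [::] xs) P x j = y by rewrite /upd; case: eqP => //; lia.
    rewrite -ej.
    apply: reg_copy_word; [apply: DN | apply: DP | apply: DN | | | | |];
      try lia.
    + by rewrite /upd gtn_eqF // nilP //; lia.
    + by rewrite /upd ltn_eqF ?nilP //; lia.
  have [t1 [T1 [ht1 ex1 hT1 _]]] := regP h1 hTD.
  have [t2 [T2 [ht2 ex2 hT2 _]]] := regP h2 hT1.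
  have [|z' [hrun' hz']] := runs_tape_eq hrun (T := fun k => T2 (P + k)).
    move=> k /=; apply: tape_eq_sym.
    have -> : nth [::] [:: x; y] k =
      upd (upd (nth [::] xs) P x) P.+1 y (P + k).
      rewrite /upd -addn1 !eqn_add2l -[X in P + k == X]addn0 eqn_add2l.
      by case: k => [|[|k]] //=; rewrite nth_nil nilP //; lia.
    by apply: hT2; exact: DP (leq_addr _ _).
  pose T3 := glue_tapes P T2 (tapes z').
  have ex3 : exec g (shift_cmd P (Raw M)) T2 t T3.
    by have := exec_shift P T2 (exec_raw hrun'); rewrite glue_tapes_id.
  have T3lt k : k < P -> T3 k = T2 k by rewrite /T3 /glue_tapes => ->.
  have T3ge k : P' <= k -> holds (T3 k) [::].
    move=> hk; rewrite /T3 /glue_tapes ltnNge (leq_trans _ hk) ?leq_addr //=.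
    rewrite (runs_tape_bound hrun') /=; last by rewrite /P' in hk; lia.
    rewrite subnKC; last by rewrite /P' in hk; lia.
    have := hT2 k (DP _ (leq_trans (leq_addr _ _) hk)).
    rewrite /upd; rewrite /P' in hk; do 2 (case: eqP => [|_]; first lia).
    by rewrite nilP //; lia.
  have T3P : word_of_tape (T3 P) = f [tuple x; y].
    by rewrite -hz /T3 /glue_tapes ltnn subnn; apply/esym/word_of_tape_eq/hz'.
  have T3N k : k < N -> holds (T3 k) (nth [::] xs k).
    move=> hk; rewrite T3lt; last lia.
    have := hT2 k (DN _ hk); rewrite /upd.
    by do 2 (case: eqP => [|_]; first lia).
  have nPn : P != n.+1 by lia.
  have := T3N n.+1 hN; rewrite nilP // => hn1.
  have [T4 [ex4 T4n hT4]] := exec_unload nPn T3P hn1.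
  pose e4 := upd (nth [::] xs) n.+1 (rev (f [tuple x; y])).
  have hn : n < N by lia.
  have nnn : n.+1 != n by lia.
  have h5 := @reg_mvrev g (fun k => k < N) n.+1 n e4 hN hn nnn.
  have [k hk|t5 [T5 [ht5 ex5 hT5 hT5']]] := regP h5 (T := T4).
    rewrite /e4 /upd; case: eqP => [->|/eqP ne] //.
    by rewrite hT4 //; [exact: T3N | lia].
  have e4n1 : e4 n.+1 = rev (f [tuple x; y]) by rewrite /e4 /upd eqxx.
  rewrite e4n1 size_rev in ht5.
  exists (t1 + (t2 + (t + (6 * size (f [tuple x; y]) + 1 + t5)))), T5; split.
  + by repeat (apply: leq_add); lia.
  + exact: exec_seq ex1 (exec_seq ex2 (exec_seq ex3 (exec_seq ex4 ex5))).
  + move=> k hk; have := hT5 k hk; rewrite e4n1 /upd nth_rcons hxs.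
    rewrite /e4 /upd (ltn_eqF (ltnSn n)) nilP //= -/(rev _) revK.
    case: (k =P n.+1) => [->|ne]; first by rewrite ltnNge leqnSn /= (gtn_eqF (ltnSn n)).
    case: (k =P n) => [->|ne']; first by rewrite ltnn.
    by case: ltnP => // le; rewrite nilP.
  move=> k hk; rewrite hT5'; last by rewrite /P' in hk; lia.
  by rewrite hT4; [exact: T3ge | |]; rewrite /P' in hk; lia.
have p1 : pb n (fun xs => 14 * tot xs + 2).
  apply: pb_add; last exact: pb_const.
  by apply: pb_mul; [exact: pb_const | exact: pb_tot].
have p2 : pb n (fun xs => 6 * (2 * tot xs + tm xs) + 1).
  apply: pb_add; last exact: pb_const.
  apply: pb_mul; first exact: pb_const.
  apply: pb_add => //.
  by apply: pb_mul; [exact: pb_const | exact: pb_tot].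
exact: (pb_add p1 (pb_add p1 (pb_add ptm (pb_add p2 p2)))).
Qed.

Lemma in_pg_dst F : dst 2 F ->
  in_pg g (fun xs : 2.-tuple word => nth [::] (F xs) 0).
Proof.
case=> N0 hF.
have [c [P' [h [[k hk] hP hc]]]] := hF N0.+2 N0.+2 (leqW (leqnSn _)) (leqnn _).
exists (compile 0 c), (('X + polyC 2) ^+ k)%R => xs.
have sxs : size xs = 2 by rewrite size_tuple.
have [h1 h2] := hc _ sxs.
have [||t [T' [ht ex hT' _]]] := h2 (fun i => tape_of_word (nth [::] xs i)).
- by move=> i _; exact: holds_tape_of_word.
- move=> i hi; rewrite nth_default; first exact: holds_tape_of_word.
  by rewrite sxs (leq_trans _ hi).
exists t, (Config (clen c) T'); split.
- exact: exec_machine.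
- by rewrite horner_exp_nat; apply: leq_trans ht (hk _ sxs).
by rewrite (word_of_holds (hT' 0 isT)).
Qed.

End Stages.

(** * Arithmetic on words *)

Section Words.

(* The length of [c] is the width of the result: addition and multiplication
   are modulo [2 ^ size c]. *)
Fixpoint addk (c a b : word) (k : bool) : word :=
  if c is _ :: c' then
    (head false a (+) head false b (+) k) ::
    addk c' (behead a) (behead b)
      (if head false a then head false b || k else head false b && k)
  else [::].

Fixpoint mulk (c u v acc : word) : word :=
  if u is b :: u' then
    mulk c u' (false :: v) (if b then addk c acc v false else acc)
  else acc.

Definition addw u v := addk (true :: u ++ v) u v false.
Definition mulw u v := mulk (u ++ v) u v [::].

Fixpoint interl (c u v : word) : word :=
  if c is _ :: c' then
    head false u :: head false v :: interl c' (behead u) (behead v)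
  else [::].

Lemma nat_of_word_lt w : nat_of_word w < 2 ^ size w.
Proof. elim: w => //= b w ih; rewrite expnS; case: b; lia. Qed.

Lemma nat_of_word_behead a : nat_of_word a = head false a + (nat_of_word (behead a)).*2.
Proof. by case: a. Qed.

Lemma size_addk c a b k : size (addk c a b k) = size c.
Proof. by elim: c a b k => //= x c ih a b k; rewrite ih. Qed.

Lemma addkE c a b k :
  nat_of_word (addk c a b k) = nat_of_word a + nat_of_word b + k %[mod 2 ^ size c].
Proof.
elim: c a b k => [|x c ih] a b k; first by rewrite !modn1.
rewrite /= (nat_of_word_behead a) (nat_of_word_behead b) expnS.
set k' := if _ then _ else _; have := ih (behead a) (behead b) k'.
set s := nat_of_word _; set A := nat_of_word _; set B := nat_of_word _.
move=> h.
have -> : head false a + A.*2 + (head false b + B.*2) + k =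
   (head false a (+) head false b (+) k) + 2 * (A + B + k').
  by rewrite /k'; case: (head false a); case: (head false b); case: (k) => /=; lia.
rewrite -mul2n -modnDmr -[RHS]modnDmr -!muln_modr.
by rewrite h.
Qed.

Lemma mulkE c u v acc :
  nat_of_word (mulk c u v acc) =
  nat_of_word acc + nat_of_word u * nat_of_word v %[mod 2 ^ size c].
Proof.
elim: u v acc => [|b u ih] v acc /=; first by rewrite addn0.
rewrite ih /=; case: b => /=.
  rewrite -modnDml addkE modnDml; congr (_ %% _); lia.
by congr (_ %% _); lia.
Qed.

Lemma size_mulk c u v acc : size (mulk c u v acc) <= maxn (size acc) (size c).
Proof.
elim: u v acc => [|b u ih] v acc /=; first exact: leq_maxl.
by apply: leq_trans (ih _ _) _; case: b => //; rewrite size_addk maxnn leq_maxr.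
Qed.

(** Both sides are congruent modulo [2 ^ size c] and smaller than it: the product by hypothesis, the
    result because it has at most [size c] letters. *)
Lemma mulk_exact c u v : nat_of_word u * nat_of_word v < 2 ^ size c ->
  nat_of_word (mulk c u v [::]) = nat_of_word u * nat_of_word v.
Proof.
move=> h; have := mulkE c u v [::]; rewrite !modn_small //.
apply: leq_trans (nat_of_word_lt _) _; rewrite leq_exp2l //.
by apply: leq_trans (size_mulk _ _ _ _) _; rewrite max0n.
Qed.

Lemma addk_exact c u v : nat_of_word u + nat_of_word v < 2 ^ size c ->
  nat_of_word (addk c u v false) = nat_of_word u + nat_of_word v.
Proof.
move=> h; have := addkE c u v false; rewrite addn0 !modn_small //.
by rewrite -(size_addk c u v false) nat_of_word_lt.
Qed.

Lemma addwE u v : nat_of_word (addw u v) = nat_of_word u + nat_of_word v.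
Proof.
apply: addk_exact; rewrite /= size_cat expnS expnD.
have := nat_of_word_lt u; have := nat_of_word_lt v; nia.
Qed.

Lemma mulwE u v : nat_of_word (mulw u v) = nat_of_word u * nat_of_word v.
Proof.
apply: mulk_exact; rewrite size_cat expnD.
have := nat_of_word_lt u; have := nat_of_word_lt v; nia.
Qed.

Lemma size_mulw u v : size (mulw u v) <= size u + size v.
Proof.
by apply: leq_trans (size_mulk _ _ _ _) _; rewrite /= max0n size_cat.
Qed.

(** Adding the empty word at width [c] is the way to pad or truncate a word to the length of [c]. *)
Lemma deinterleave_interl c u v :
  deinterleave (interl c u v) = (addk c u [::] false, addk c v [::] false).
Proof.
elim: c u v => //= x c ih u v; rewrite ih !addbF.
by case: (head false u); case: (head false v).
Qed.

Lemma has_nat_of_word w : has id w = (nat_of_word w != 0).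
Proof. by elim: w => //= b w ->; case: b => //=; rewrite double_eq0. Qed.

End Words.

(** * Programs for arithmetic on words *)

Section WordPrograms.
Variable g : word -> word.

Notation st := (st g).
Notation fp := (fp g).
Notation fp1 f := (fp 1 (fun xs => f (nth [::] xs 0))).
Notation fp2 f := (fp 2 (fun xs => f (nth [::] xs 0) (nth [::] xs 1))).
Notation fp3 f :=
  (fp 3 (fun xs => f (nth [::] xs 0) (nth [::] xs 1) (nth [::] xs 2))).
Lemma fp_app2 n f a b : fp2 f -> fp n a -> fp n b ->
  fp n (fun xs => f (a xs) (b xs)).
Proof.
move=> hf ha hb; apply: (@fp_comp g n 2 (fun xs => [:: a xs; b xs]) _ _ hf) => //.
exact: st_cons.
Qed.

Lemma fp_app3 n f a b c : fp3 f -> fp n a -> fp n b -> fp n c ->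
  fp n (fun xs => f (a xs) (b xs) (c xs)).
Proof.
move=> hf ha hb hc.
apply: (@fp_comp g n 3 (fun xs => [:: a xs; b xs; c xs]) _ _ hf) => //.
by do 2 apply: st_cons => //.
Qed.

Lemma fp_bit_head n f : fp n f -> fp n (fun xs => [:: head false (f xs)]).
Proof.
move=> hf; apply: (fp_ext (fp_if hf (fp_const g n [:: true]) (fp_const g n [:: false]))).
by move=> xs _; case: (head false _).
Qed.

Lemma fp_bit_if n (p q r : seq word -> bool) : fp n (fun xs => [:: p xs]) ->
  fp n (fun xs => [:: q xs]) -> fp n (fun xs => [:: r xs]) ->
  fp n (fun xs => [:: if p xs then q xs else r xs]).
Proof.
by move=> hp hq hr; apply: (fp_ext (fp_if hp hq hr)) => xs _ /=; case: ifP.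
Qed.

Lemma fp_cons_bit n (p : seq word -> bool) f : fp n (fun xs => [:: p xs]) ->
  fp n f -> fp n (fun xs => p xs :: f xs).
Proof.
move=> hp hf.
apply: (fp_ext (fp_if hp (fp_cons true hf) (fp_cons false hf))) => xs _ /=.
by case: (p xs).
Qed.

Lemma fp_bit_const n (b : bool) : fp n (fun=> [:: b]).
Proof. exact: fp_const. Qed.

Lemma fp_bit_and n (p q : seq word -> bool) : fp n (fun xs => [:: p xs]) ->
  fp n (fun xs => [:: q xs]) -> fp n (fun xs => [:: p xs && q xs]).
Proof.
move=> hp hq; apply: (fp_ext (fp_bit_if hp hq (fp_bit_const n false))).
by move=> xs _; case: (p xs).
Qed.

Lemma fp_bit_or n (p q : seq word -> bool) : fp n (fun xs => [:: p xs]) ->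
  fp n (fun xs => [:: q xs]) -> fp n (fun xs => [:: p xs || q xs]).
Proof.
move=> hp hq; apply: (fp_ext (fp_bit_if hp (fp_bit_const n true) hq)).
by move=> xs _; case: (p xs).
Qed.

Lemma fp_bit_xor n (p q : seq word -> bool) : fp n (fun xs => [:: p xs]) ->
  fp n (fun xs => [:: q xs]) -> fp n (fun xs => [:: p xs (+) q xs]).
Proof.
move=> hp hq.
have hnq := fp_bit_if hq (fp_bit_const n false) (fp_bit_const n true).
apply: (fp_ext (fp_bit_if hp hnq hq)).
by move=> xs _; case: (p xs); case: (q xs).
Qed.

Lemma st_loop_linear n F C : (forall b, st n (F b)) ->
  (forall b ys, size ys = n -> size (F b ys) = n) ->
  (forall b ys, size ys = n -> tot (F b ys) <= tot ys + C) ->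
  st n.+1 (iter_word F).
Proof.
move=> sF zF hF; apply: (@st_loop g n F (fun xs => C.+1 * tot xs) sF zF).
  by apply: pb_mul; [exact: pb_const | exact: pb_tot].
have h a ys : size ys = n -> tot (iter_word F (a :: ys)) <= tot ys + C * size a.
  rewrite /iter_word /=; elim: a ys => [|b a ih] ys hys /=; first by lia.
  by apply: leq_trans (ih _ (zF _ _ hys)) _; have := hF b ys hys; lia.
move=> a ys hys; apply: leq_trans (h _ _ hys) _.
by rewrite {2}/tot /= -/(tot ys); nia.
Qed.

Lemma fp_catrev : fp2 catrev.
Proof.
pose F (b : bool) (ys : seq word) := [:: b :: nth [::] ys 0].
have hF : st 2 (iter_word F).
  apply: (@st_loop_linear 1 F 1) => [b|//|b [|y []] //= _].
    by apply: st_cons (st_nil g 1); apply: fp_cons; exact: fp_var.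
  by rewrite /tot /=; lia.
apply: (fp_ext (fp_comp hF (fp_var g (isT : 0 < 1)) _)).
  move=> [|a [|b []]] //= _; rewrite /iter_word /=.
  by elim: a [:: b] (erefl : size [:: b] = 1) => //= x a ih ys h; apply: ih.
move=> [|a [|b []]] //= _; rewrite /iter_word /=.
by elim: a b => //= x a ih b; rewrite ih.
Qed.

Lemma fp_rev : fp1 rev.
Proof.
exact: (@fp_app2 1 catrev _ _ fp_catrev (fp_var g (isT : 0 < 1)) (fp_nil g 1)).
Qed.

Lemma fp_cat : fp2 cat.
Proof.
apply: (fp_ext (@fp_app2 2 catrev (fun xs => rev (nth [::] xs 0)) _ fp_catrev
  (fp_app1 fp_rev (fp_var g (isT : 0 < 2))) (fp_var g (isT : 1 < 2)))).
by move=> xs _; rewrite catrevE revK.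
Qed.

Lemma fp_addk0 : fp3 (fun c a b => addk c a b false).
Proof.
pose F (_ : bool) (ys : seq word) :=
  let a := nth [::] ys 0 in let b := nth [::] ys 1 in
  let k := head false (nth [::] ys 2) in
  [:: behead a; behead b;
      [:: if head false a then head false b || k else head false b && k];
      (head false a (+) head false b (+) k) :: nth [::] ys 3].
have hF : st 5 (iter_word F).
  apply: (@st_loop_linear 4 F 2) => [x|//|x [|a [|b [|k [|o []]]]] //= _].
    apply: st_cons; first by apply: fp_behead; exact: fp_var.
    apply: st_cons; first by apply: fp_behead; exact: fp_var.
    apply: st_cons.
      apply: fp_bit_if; first by apply: fp_bit_head; exact: fp_var.
        by apply: fp_bit_or; apply: fp_bit_head; exact: fp_var.
      by apply: fp_bit_and; apply: fp_bit_head; exact: fp_var.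
    apply: st_cons (st_nil g 4); apply: fp_cons_bit; last exact: fp_var.
    by do 2?apply: fp_bit_xor; apply: fp_bit_head; exact: fp_var.
  by rewrite /tot /= !size_behead; lia.
(* Three components are stated as themselves: only the length four and the accumulator matter. The
   latter collects the bits of the sum in reverse. *)
have spec c a b k o (s := iter_word F [:: c; a; b; k; o]) :
    s = [:: nth [::] s 0; nth [::] s 1; nth [::] s 2;
      catrev (addk c a b (head false k)) o].
  rewrite {}/s /iter_word /=; elim: c a b k o => //= x c ih a b k o.
  by rewrite {1}ih.
have v i : i < 3 -> fp 3 (fun xs => nth [::] xs i) by exact: fp_var.
have hG : st 3 (fun xs =>
    [:: nth [::] xs 0; nth [::] xs 1; nth [::] xs 2; [::]; [::]]).
  do 3 (apply: st_cons; first exact: v).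
  by do 2 (apply: st_cons; first exact: fp_nil); exact: st_nil.
have zI xs : size xs = 5 -> size (iter_word F xs) = 4.
  by case: xs => [|c [|a [|b [|k [|o []]]]]] // _; rewrite spec.
have h := @fp_comp g 5 4 (iter_word F) _ hF (fp_var g (isT : 3 < 4)) zI.
have h3 := @fp_comp g 3 5 _ _ hG h (fun _ _ => erefl).
apply: (fp_ext (fp_app1 fp_rev h3)) => xs _.
by rewrite spec /= -/(rev _) revK.
Qed.

Lemma fp_addk n c a b : fp n c -> fp n a -> fp n b ->
  fp n (fun xs => addk (c xs) (a xs) (b xs) false).
Proof. exact: (@fp_app3 n (fun c a b => addk c a b false) c a b fp_addk0). Qed.

Lemma fp_mulk0 : fp3 (fun c u v => mulk c u v [::]).
Proof.
pose F (b : bool) (ys : seq word) :=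
  let c := nth [::] ys 0 in let v := nth [::] ys 1 in let acc := nth [::] ys 2 in
  [:: c; false :: v; if b then addk c acc v false else acc].
have spec u c v acc : iter_word F [:: u; c; v; acc] =
    [:: c; nseq (size u) false ++ v; mulk c u v acc].
  rewrite /iter_word /=; elim: u v acc => //= b u ih v acc.
  rewrite ih; congr [:: _; _; _].
  by elim: (size u) => //= k ->.
have hF : st 4 (iter_word F).
  (* A pass can lengthen the accumulator by [size c], so no constant increment is available; the
     closed form [spec] provides the bound. *)
  apply: (@st_loop g 3 F (fun xs => 2 * tot xs)).
  - move=> b; have v i : i < 3 -> fp 3 (fun xs => nth [::] xs i) by exact: fp_var.
    apply: st_cons; first exact: v.
    apply: st_cons; first by apply: fp_cons; exact: v.
    apply: st_cons (st_nil g 3).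
    by case: b; [apply: fp_addk; exact: v | exact: v].
  - by [].
  - by apply: pb_mul; [exact: pb_const | exact: pb_tot].
  move=> u [|c [|v [|acc []]]] //= _; rewrite spec /tot /= size_cat size_nseq.
  have := size_mulk c u v acc; lia.
have hG : st 3 (fun xs => [:: nth [::] xs 1; nth [::] xs 0; nth [::] xs 2; [::]]).
  do 3 (apply: st_cons; first exact: fp_var).
  by apply: st_cons; [exact: fp_nil | exact: st_nil].
have zI xs : size xs = 4 -> size (iter_word F xs) = 3.
  by case: xs => [|u [|c [|v [|a []]]]] // _; rewrite spec.
have h := @fp_comp g 4 3 (iter_word F) _ hF (fp_var g (isT : 2 < 3)) zI.
apply: (fp_ext (@fp_comp g 3 4 _ _ hG h (fun _ _ => erefl))) => xs _.
by rewrite spec.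
Qed.

Lemma fp_mulk n c u v : fp n c -> fp n u -> fp n v ->
  fp n (fun xs => mulk (c xs) (u xs) (v xs) [::]).
Proof. exact: (@fp_app3 n (fun c u v => mulk c u v [::]) c u v fp_mulk0). Qed.

Lemma fp_addw n u v : fp n u -> fp n v -> fp n (fun xs => addw (u xs) (v xs)).
Proof.
move=> hu hv; apply: fp_addk => //; apply: fp_cons.
exact: (fp_app2 fp_cat).
Qed.

Lemma fp_mulw n u v : fp n u -> fp n v -> fp n (fun xs => mulw (u xs) (v xs)).
Proof. by move=> hu hv; apply: fp_mulk => //; exact: (fp_app2 fp_cat). Qed.

Lemma fp_interl0 : fp3 interl.
Proof.
pose F (_ : bool) (ys : seq word) :=
  let u := nth [::] ys 0 in let v := nth [::] ys 1 in
  [:: behead u; behead v; head false v :: head false u :: nth [::] ys 2].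
have v i : i < 3 -> fp 3 (fun xs => nth [::] xs i) by exact: fp_var.
have hF : st 4 (iter_word F).
  apply: (@st_loop_linear 3 F 2) => [x|//|x [|a [|b [|o []]]] //= _].
    apply: st_cons; first by apply: fp_behead; exact: v.
    apply: st_cons; first by apply: fp_behead; exact: v.
    apply: st_cons (st_nil g 3).
    apply: fp_cons_bit; first by apply: fp_bit_head; exact: v.
    by apply: fp_cons_bit; [apply: fp_bit_head|]; exact: v.
  by rewrite /tot /= !size_behead; lia.
have spec c a b o : iter_word F [:: c; a; b; o] =
    [:: nth [::] (iter_word F [:: c; a; b; o]) 0;
      nth [::] (iter_word F [:: c; a; b; o]) 1; catrev (interl c a b) o].
  rewrite /iter_word /=; elim: c a b o => //= x c ih a b o.
  by rewrite {1}ih.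
have hG : st 3 (fun xs => [:: nth [::] xs 0; nth [::] xs 1; nth [::] xs 2; [::]]).
  do 3 (apply: st_cons; first exact: v).
  by apply: st_cons; [exact: fp_nil | exact: st_nil].
have zI xs : size xs = 4 -> size (iter_word F xs) = 3.
  by case: xs => [|c [|a [|b [|o []]]]] // _; rewrite spec.
have h := @fp_comp g 4 3 (iter_word F) _ hF (fp_var g (isT : 2 < 3)) zI.
have h3 := @fp_comp g 3 4 _ _ hG h (fun _ _ => erefl).
apply: (fp_ext (fp_app1 fp_rev h3)) => xs _.
by rewrite spec /= -/(rev _) revK.
Qed.

Lemma st_deinterleave :
  st 1 (fun xs => [:: (deinterleave (nth [::] xs 0)).1;
    (deinterleave (nth [::] xs 0)).2]).
Proof.
(* The first word is a parity flag; an unpaired last letter goes to the first half, as in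
   [deinterleave]. *)
pose F (b : bool) (ys : seq word) :=
  let u := nth [::] ys 1 in let v := nth [::] ys 2 in
  if head false (nth [::] ys 0) then [:: [:: false]; u; b :: v]
  else [:: [:: true]; b :: u; v].
have v i : i < 3 -> fp 3 (fun xs => nth [::] xs i) by exact: fp_var.
have zF b ys : size (F b ys) = 3 by rewrite /F; case: ifP.
have hF : st 4 (iter_word F).
  apply: (@st_loop_linear 3 F 2) => [b|//|b [|a [|u [|w []]]] //= _].
    apply: st_if; first exact: v.
      apply: st_cons; first exact: fp_const.
      apply: st_cons; first exact: v.
      by apply: st_cons (st_nil g 3); apply: fp_cons; exact: v.
    apply: st_cons; first exact: fp_const.
    apply: st_cons; first by apply: fp_cons; exact: v.
    by apply: st_cons (st_nil g 3); exact: v.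
  by rewrite /F /=; case: ifP; rewrite /tot /=; lia.
have zI xs : size xs = 4 -> size (iter_word F xs) = 3.
  case: xs => [|c ys] // [hys]; rewrite /iter_word /=.
  by elim: c ys hys => //= b c ih ys hys; rewrite ih.
have spec w p u v' : head false p = false ->
    behead (iter_word F [:: w; p; u; v']) =
    [:: catrev (deinterleave w).1 u; catrev (deinterleave w).2 v'].
  move=> hp; rewrite /iter_word /=.
  have [m] := ubnP (size w); elim: m => // m ih in w p u v' hp *.
  case: w => [|a [|b w]] //= hm; first by rewrite /F /= hp.
  rewrite [F a _]/F /= hp [F b _]/F /= ih //; last by lia.
  by case: (deinterleave w).
have hG : st 1 (fun xs => [:: nth [::] xs 0; [::]; [::]; [::]]).
  apply: st_cons; first exact: fp_var.
  by do 3 (apply: st_cons; first exact: fp_nil); exact: st_nil.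
have hI := st_comp hG hF (fun _ _ => erefl).
have hJ := st_comp hI (st_behead g 3) 
  (fun xs _ => zI [:: nth [::] xs 0; [::]; [::]; [::]] erefl).
have hR : st 2 (fun xs => [:: rev (nth [::] xs 0); rev (nth [::] xs 1)]).
  by do 2 (apply: st_cons; first by apply: (fp_app1 fp_rev); exact: fp_var); exact: st_nil.
apply: (st_ext (st_comp hJ hR _)).
  by move=> xs _; rewrite spec.
by move=> xs _; rewrite spec //= -!/(rev _) !revK.
Qed.

Lemma fp_has n w : fp n w -> fp n (fun xs => [:: has id (w xs)]).
Proof.
pose F (b : bool) (ys : seq word) := if b then [:: [:: true]] else [:: nth [::] ys 0].
have hF : st 2 (iter_word F).
  apply: (@st_loop_linear 1 F 1) => [b|b ys|b [|y []] //= _].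
  - by case: b; apply: st_cons (st_nil g 1); [exact: fp_const | exact: fp_var].
  - by case: b.
  by rewrite /F; case: b; rewrite /tot /=; lia.
have spec u o : iter_word F [:: u; [:: o]] = [:: [:: has id u || o]].
  rewrite /iter_word /=; elim: u o => //= b u ih o.
  by case: b; rewrite /= ih ?orbT.
move=> hw.
have hG : st n (fun xs => [:: w xs; [:: false]]).
  by apply: st_cons => //; apply: st_cons (st_nil g n); exact: fp_const.
apply: (st_ext (st_comp hG hF (fun _ _ => erefl))) => xs _.
by rewrite spec orbF.
Qed.

Lemma fp_nseq K n w : fp n w -> fp n (fun xs => nseq (K * size (w xs)) true).
Proof.
pose F (_ : bool) (ys : seq word) := [:: nseq K true ++ nth [::] ys 0].
have hF : st 2 (iter_word F).
  apply: (@st_loop_linear 1 F K) => [b|//|b [|y []] //= _].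
    apply: st_cons (st_nil g 1); elim: (K) => [|k ih] /=; first exact: fp_var.
    exact: fp_cons.
  by rewrite /tot /= size_cat size_nseq; lia.
have spec u k : iter_word F [:: u; nseq k true] = [:: nseq (K * size u + k) true].
  rewrite /iter_word /=; elim: u k => [|b u ih] k /=; first by rewrite muln0.
  have -> : F b [:: nseq k true] = [:: nseq (K + k) true] by rewrite nseqD.
  by rewrite ih; congr [:: nseq _ _]; lia.
move=> hw.
have hG : st n (fun xs => [:: w xs; [::]]).
  by apply: st_cons => //; apply: st_cons (st_nil g n); exact: fp_nil.
apply: (st_ext (st_comp hG hF (fun _ _ => erefl))) => xs _.
by rewrite (spec _ 0) addn0.
Qed.

End WordPrograms.

(** * Fractions as pairs of words *)

Section RationalWords.

(* Numerator and denominator of an oracle answer, with negative values replaced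
   by 0 and with the junk value n / 0 = 0 given a positive denominator. *)
Definition numw (o : word) : word :=
  if head false o then [::] else
  if has id (deinterleave (behead o)).2 then (deinterleave (behead o)).1
  else [::].

Definition denw (o : word) : word :=
  if has id (deinterleave (behead o)).2 then (deinterleave (behead o)).2
  else [:: true].

(** [pad u v] and [pad v u] have the same length, as the width in [sqrt_step] requires. *)
Definition pad (u v : word) : word := addk (u ++ v) u [::] false.

(* With a = m / n and y = p / q, this is y <- (a + y) / (1 + y); the width [c]
   excludes overflow as long as m, n and p, q have equal lengths. *)
Definition sqrt_step (b : bool) (ys : seq word) :=
  let m := nth [::] ys 0 in let n := nth [::] ys 1 in
  let p := nth [::] ys 2 in let q := nth [::] ys 3 in
  let c := true :: p ++ m in
  [:: m; n; addk c (mulk c m q [::]) (mulk c n p [::]) false;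
      addk c (mulk c n p [::]) (mulk c n q [::]) false].

Definition sqrt_words (R o : word) : seq word :=
  iter_word sqrt_step [:: R; pad (numw o) (denw o); pad (denw o) (numw o);
    [:: true]; [:: true]].

Definition sqrt_num (R o : word) : word := nth [::] (sqrt_words R o) 2.
Definition sqrt_den (R o : word) : word := nth [::] (sqrt_words R o) 3.

Definition prod_step (b : bool) (ys : seq word) :=
  let nb := if b then nth [::] ys 4 else nth [::] ys 2 in
  let db := if b then nth [::] ys 5 else nth [::] ys 3 in
  [:: mulw (nth [::] ys 0) nb; mulw (nth [::] ys 1) db;
      nth [::] ys 2; nth [::] ys 3; nth [::] ys 4; nth [::] ys 5].

Definition prod_words (w : word) (ys : seq word) : seq word :=
  iter_word prod_step (w :: ys).

(* The factor 2^-s / sqrt beta, where 2^-s = x / (y + z). *)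
Definition factor_num (x y z b R : word) : word :=
  mulw (mulw (numw x) (mulw (denw y) (denw z))) (sqrt_den R b).
Definition factor_den (x y z b R : word) : word :=
  mulw (mulw (denw x)
     (addw (mulw (numw y) (denw z)) (mulw (numw z) (denw y)))) (sqrt_num R b).

Definition fraction_word (u v : word) : word := false :: interl (u ++ v) u v.

Definition output_word (w o x y z b0 b1 R : word) : word :=
  let s := prod_words w [:: numw o; denw o; factor_num x y z b0 R;
    factor_den x y z b0 R; factor_num x y z b1 R; factor_den x y z b1 R] in
  fraction_word (nth [::] s 0) (nth [::] s 1).

End RationalWords.

(** * Programs for fractions *)

Section RationalPrograms.
Variable g : word -> word.
Notation st := (st g).
Notation fp := (fp g).

Lemma st_deinterleave_app n o : fp n o -> st n (fun xs =>
  [:: (deinterleave (o xs)).1; (deinterleave (o xs)).2]).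
Proof.
move=> ho; exact: (@st_comp g n 1 (fun xs => [:: o xs]) _ ho (st_deinterleave g)).
Qed.

Lemma fp_numw n o : fp n o -> fp n (fun xs => numw (o xs)).
Proof.
move=> ho; have hd := st_deinterleave_app (fp_behead ho).
have h1 := fp_comp hd (fp_var g (isT : 0 < 2)) (fun _ _ => erefl).
have h2 := fp_comp hd (fp_var g (isT : 1 < 2)) (fun _ _ => erefl).
apply: (fp_ext (fp_if ho (fp_nil g n) (fp_if (fp_has h2) h1 (fp_nil g n)))).
by [].
Qed.

Lemma fp_denw n o : fp n o -> fp n (fun xs => denw (o xs)).
Proof.
move=> ho; have hd := st_deinterleave_app (fp_behead ho).
have h2 := fp_comp hd (fp_var g (isT : 1 < 2)) (fun _ _ => erefl).
by apply: (fp_ext (fp_if (fp_has h2) h2 (fp_const g n [:: true]))).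
Qed.

Lemma fp_pad n u v : fp n u -> fp n v -> fp n (fun xs => pad (u xs) (v xs)).
Proof.
move=> hu hv; apply: fp_addk => //; last exact: fp_nil.
by apply: (fp_app2 (fp_cat g)).
Qed.

Lemma size_iter_word F k a ys : (forall b zs, size zs = k -> size (F b zs) = k) ->
  size ys = k -> size (iter_word F (a :: ys)) = k.
Proof.
by move=> zF; rewrite /iter_word /=; elim: a ys => //= b a ih ys h; rewrite ih ?zF.
Qed.

Lemma st_sqrt_step b : st 4 (sqrt_step b).
Proof.
have v i : i < 4 -> fp 4 (fun xs => nth [::] xs i) by exact: fp_var.
have hc : fp 4 (fun xs => true :: nth [::] xs 2 ++ nth [::] xs 0).
  by apply: fp_cons; apply: (fp_app2 (fp_cat g)); exact: v.
do 2 (apply: st_cons; first exact: v).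
apply: st_cons; first by apply: fp_addk => //; apply: fp_mulk => //; exact: v.
apply: st_cons (st_nil g 4).
by apply: fp_addk => //; apply: fp_mulk => //; exact: v.
Qed.

Lemma st_sqrt_loop : st 5 (iter_word sqrt_step).
Proof.
apply: (@st_loop g 4 sqrt_step
  (fun xs => tot xs + 2 * (tot xs + tot xs * (1 + tot xs)))) => //.
- exact: st_sqrt_step.
- apply: pb_add; first exact: pb_tot.
  apply: pb_mul; first exact: pb_const.
  apply: pb_add; first exact: pb_tot.
  apply: pb_mul; first exact: pb_tot.
  by apply: pb_add; [exact: pb_const | exact: pb_tot].
move=> a [|m [|n [|p [|q []]]]] //= _.
(* Each pass makes both lengths [1 + size p + size m]; the increment depends on the input but stays
   the same throughout the loop. *)
have H : exists p' q',
  [/\ iter_word sqrt_step [:: a; m; n; p; q] = [:: m; n; p'; q'],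
    size p' <= maxn (size p) (size q) + size a * (1 + size m) &
    size q' <= maxn (size p) (size q) + size a * (1 + size m)].
  rewrite /iter_word /=; elim: a p q => [|b a ih] p q /=.
    by exists p, q; split=> //; lia.
  pose c := true :: p ++ m.
  have [p' [q' [-> hp hq]]] := ih (addk c (mulk c m q [::]) (mulk c n p [::]) false)
    (addk c (mulk c n p [::]) (mulk c n q [::]) false).
  move: hp hq; rewrite !size_addk /= size_cat maxnn => hp hq.
  exists p', q'; split=> //; rewrite mulSn.
    by apply: leq_trans hp _; have := leq_maxl (size p) (size q); lia.
  by apply: leq_trans hq _; have := leq_maxl (size p) (size q); lia.
have [p' [q' [-> hp hq]]] := H; rewrite /tot /=; nia.
Qed.

Lemma st_sqrt_words n R o : fp n R -> fp n o ->
  st n (fun xs => sqrt_words (R xs) (o xs)).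
Proof.
move=> hR ho.
apply: (@st_comp g n 5 (fun xs => [:: R xs; pad (numw (o xs)) (denw (o xs));
  pad (denw (o xs)) (numw (o xs)); [:: true]; [:: true]]) _ _ st_sqrt_loop) => //.
have h1 := fp_numw ho; have h2 := fp_denw ho.
apply: st_cons => //.
do 2 (apply: st_cons; first exact: fp_pad).
by do 2 (apply: st_cons; first exact: fp_const); exact: st_nil.
Qed.

Lemma fp_sqrt_num n R o : fp n R -> fp n o ->
  fp n (fun xs => sqrt_num (R xs) (o xs)).
Proof.
move=> hR ho.
apply: (fp_comp (st_sqrt_words hR ho) (fp_var g (isT : 2 < 4))) => xs _.
exact: (@size_iter_word _ 4).
Qed.

Lemma fp_sqrt_den n R o : fp n R -> fp n o ->
  fp n (fun xs => sqrt_den (R xs) (o xs)).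
Proof.
move=> hR ho.
apply: (fp_comp (st_sqrt_words hR ho) (fp_var g (isT : 3 < 4))) => xs _.
exact: (@size_iter_word _ 4).
Qed.

Lemma st_prod_step b : st 6 (prod_step b).
Proof.
have v i : i < 6 -> fp 6 (fun xs => nth [::] xs i) by exact: fp_var.
apply: st_cons; first by apply: fp_mulw; [|case: b]; exact: v.
apply: st_cons; first by apply: fp_mulw; [|case: b]; exact: v.
by do 4 (apply: st_cons; first exact: v); exact: st_nil.
Qed.

Lemma st_prod_loop : st 7 (iter_word prod_step).
Proof.
apply: (@st_loop g 6 prod_step (fun xs => tot xs + tot xs * tot xs)) => //.
- exact: st_prod_step.
- apply: pb_add; first exact: pb_tot.
  by apply: pb_mul; exact: pb_tot.
move=> a [|P [|Q [|n0 [|d0 [|n1 [|d1 []]]]]]] //= _.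
(* Lengths add under [mulw] and the factors stay fixed, so the growth is linear in the number of
   passes. *)
suff : tot (iter_word prod_step [:: a; P; Q; n0; d0; n1; d1]) <=
    tot [:: P; Q; n0; d0; n1; d1] + size a * tot [:: n0; d0; n1; d1].
  by rewrite /tot /=; nia.
rewrite /iter_word /=; elim: a P Q => [|b a ih] P Q /=; first lia.
apply: leq_trans (ih _ _) _; rewrite mulSn /tot /=.
have := size_mulw P (if b then n1 else n0).
have := size_mulw Q (if b then d1 else d0).
case: b => /=; lia.
Qed.

Lemma fp_factor_num n x y z b R : fp n x -> fp n y -> fp n z -> fp n b ->
  fp n R -> fp n (fun xs => factor_num (x xs) (y xs) (z xs) (b xs) (R xs)).
Proof.
move=> hx hy hz hb hR; apply: fp_mulw; last exact: fp_sqrt_den.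
by apply: fp_mulw; [exact: fp_numw | apply: fp_mulw; exact: fp_denw].
Qed.

Lemma fp_factor_den n x y z b R : fp n x -> fp n y -> fp n z -> fp n b ->
  fp n R -> fp n (fun xs => factor_den (x xs) (y xs) (z xs) (b xs) (R xs)).
Proof.
move=> hx hy hz hb hR; apply: fp_mulw; last exact: fp_sqrt_num.
apply: fp_mulw; first exact: fp_denw.
by apply: fp_addw; apply: fp_mulw; (exact: fp_numw || exact: fp_denw).
Qed.

Lemma fp_fraction_word n u v : fp n u -> fp n v ->
  fp n (fun xs => fraction_word (u xs) (v xs)).
Proof.
move=> hu hv; apply: fp_cons; apply: (fp_app3 (fp_interl0 g)) => //.
exact: (fp_app2 (fp_cat g)).
Qed.

Lemma fp_output_word n w o x y z b0 b1 R : fp n w -> fp n o -> fp n x ->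
  fp n y -> fp n z -> fp n b0 -> fp n b1 -> fp n R ->
  fp n (fun xs => output_word (w xs) (o xs) (x xs) (y xs) (z xs) (b0 xs)
    (b1 xs) (R xs)).
Proof.
move=> hw ho hx hy hz h0 h1 hR.
have hs : st n (fun xs => iter_word prod_step [:: w xs; numw (o xs); denw (o xs);
    factor_num (x xs) (y xs) (z xs) (b0 xs) (R xs);
    factor_den (x xs) (y xs) (z xs) (b0 xs) (R xs);
    factor_num (x xs) (y xs) (z xs) (b1 xs) (R xs);
    factor_den (x xs) (y xs) (z xs) (b1 xs) (R xs)]).
  apply: (st_comp _ st_prod_loop); last by [].
  apply: st_cons => //; apply: st_cons; first exact: fp_numw.
  apply: st_cons; first exact: fp_denw.
  apply: st_cons; first exact: fp_factor_num.
  apply: st_cons; first exact: fp_factor_den.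
  apply: st_cons; first exact: fp_factor_num.
  by apply: st_cons (st_nil g n); exact: fp_factor_den.
have zs xs : size (iter_word prod_step [:: w xs; numw (o xs); denw (o xs);
    factor_num (x xs) (y xs) (z xs) (b0 xs) (R xs);
    factor_den (x xs) (y xs) (z xs) (b0 xs) (R xs);
    factor_num (x xs) (y xs) (z xs) (b1 xs) (R xs);
    factor_den (x xs) (y xs) (z xs) (b1 xs) (R xs)]) = 6.
  exact: (@size_iter_word _ 6).
apply: fp_fraction_word.
  exact: (fp_comp hs (fp_var g (isT : 0 < 6)) (fun xs _ => zs xs)).
exact: (fp_comp hs (fp_var g (isT : 1 < 6)) (fun xs _ => zs xs)).
Qed.

End RationalPrograms.

(** * The complete computation *)

Section Pipeline.
Variable g : word -> word.

(** One word serves as the unary precision of every call and, by its length, as the number of square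
    root iterations. *)
Definition precision (K : nat) (w r : word) : word :=
  nseq (K * (size w + size r + 1)) true.

Definition pipeline (K : nat) (fd f0 f1 : 2.-tuple word -> word) (w r : word) :=
  let R := precision K w r in
  output_word w (fd [tuple w; R]) (fd [tuple [::]; R]) (fd [tuple [:: false]; R])
    (fd [tuple [:: true]; R]) (f0 [tuple [::]; R]) (f1 [tuple [::]; R]) R.

Lemma in_pg_pipeline K fd f0 f1 : in_pg g fd -> in_pg g f0 -> in_pg g f1 ->
  in_pg g (fun xs : 2.-tuple word =>
    pipeline K fd f0 f1 (nth [::] xs 0) (nth [::] xs 1)).
Proof.
move=> hd h0 h1.
have v i n : i < n -> fp g n (fun xs => nth [::] xs i) by exact: fp_var.
(* The arguments of all six calls are prepared at once; the answers are then appended as entries 5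
   to 10, and a clean program finishes. *)
pose A (xs : seq word) := [:: nth [::] xs 0;
  precision K (nth [::] xs 0) (nth [::] xs 1); [::]; [:: false]; [:: true]].
have sA : st g 2 A.
  apply: st_cons; first exact: v.
  apply: st_cons.
    apply: (fp_ext (fp_nseq K (fp_cons true
      (@fp_app2 g 2 cat _ _ (fp_cat g) (v 0 2 isT) (v 1 2 isT))))) => xs _.
    by rewrite /precision /= size_cat addn1.
  apply: st_cons; first exact: fp_nil.
  by do 2 (apply: st_cons; first exact: fp_const); exact: st_nil.
have step n F f i j : dst g 2 F -> (forall xs, size xs = 2 -> size (F xs) = n) ->
    in_pg g f -> i < n -> j < n ->
    dst g 2 (fun xs => rcons (F xs) (f [tuple nth [::] (F xs) i; nth [::] (F xs) j])).
  move=> hF zF hf hi hj.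
  exact: (@dst_comp g 2 n F _ hF (dst_call hf hi hj) zF).
have s1 := step 5 _ fd 0 1 (dst_st sA) (fun _ _ => erefl) hd isT isT.
have s2 := step 6 _ fd 2 1 s1 (fun _ _ => erefl) hd isT isT.
have s3 := step 7 _ fd 3 1 s2 (fun _ _ => erefl) hd isT isT.
have s4 := step 8 _ fd 4 1 s3 (fun _ _ => erefl) hd isT isT.
have s5 := step 9 _ f0 2 1 s4 (fun _ _ => erefl) h0 isT isT.
have s6 := step 10 _ f1 2 1 s5 (fun _ _ => erefl) h1 isT isT.
have hH := @fp_output_word g 11 _ _ _ _ _ _ _ _ (v 0 11 isT) (v 5 11 isT)
  (v 6 11 isT) (v 7 11 isT) (v 8 11 isT) (v 9 11 isT) (v 10 11 isT) (v 1 11 isT).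
exact: (in_pg_dst (dst_comp s6 (dst_st hH) (fun _ _ => erefl))).
Qed.

End Pipeline.

Local Open Scope classical_set_scope.
Local Open Scope ring_scope.

(** * Real values of words *)

Section Values.
Variable R : realType.

Definition qval (u v : word) : R := (nat_of_word u)%:R / (nat_of_word v)%:R.

Definition wval (o : word) : R := qval (numw o) (denw o).

Lemma qval_ge0 u v : 0 <= qval u v.
Proof. by rewrite /qval divr_ge0. Qed.

Lemma denw_gt0 o : (0 < nat_of_word (denw o))%N.
Proof.
by rewrite /denw; case: ifP => //; rewrite has_nat_of_word lt0n.
Qed.

Lemma ratr_fraction_word u v : ratr (rat_of_word (fraction_word u v)) = qval u v.
Proof.
rewrite /fraction_word /rat_of_word deinterleave_interl.
rewrite !addk_exact /= ?addn0; last 2 first.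
- rewrite size_cat expnD; have := nat_of_word_lt v.
  have : (0 < 2 ^ size u)%N by rewrite expn_gt0.
  nia.
- rewrite size_cat expnD; have := nat_of_word_lt u.
  have : (0 < 2 ^ size v)%N by rewrite expn_gt0.
  nia.
by rewrite expr0 mul1r rmorphM /= fmorphV /= !ratr_nat.
Qed.

(** Replacing a negative value by 0 moves it closer to [x], and a zero denominator already means the
    value 0. *)
Lemma wval_dist o (x : R) : 0 <= x ->
  `|wval o - x| <= `|ratr (rat_of_word o) - x|.
Proof.
move=> hx; rewrite /wval /qval /numw /denw.
case: o => [|b o] /=; first by rewrite mul0r rmorph0.
case E : (deinterleave o) => [u v] /=.
rewrite rmorphM /= fmorphV /= rmorphM /= rmorphXn /= rmorphN1 !ratr_nat.
case: b => /=.
  rewrite expr1 mulN1r mul0r sub0r mulNr -opprD !normrN ger0_norm //.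
  rewrite ger0_norm ?lerDr ?divr_ge0 //.
  by rewrite addr_ge0 // divr_ge0.
rewrite expr0 mul1r; case: ifP => //; rewrite has_nat_of_word => /negbFE/eqP ->.
by rewrite invr0 mulr0 mul0r.
Qed.

Definition sqrt_iter (a : R) (k : nat) : R :=
  iter k (fun y => (a + y) / (1 + y)) 1.

Lemma sqrt_stepE w m n p q : size m = size n -> size p = size q ->
  (0 < nat_of_word n)%N -> (0 < nat_of_word p)%N -> (0 < nat_of_word q)%N ->
  exists p' q', [/\ iter_word sqrt_step [:: w; m; n; p; q] = [:: m; n; p'; q'],
    (0 < nat_of_word p')%N, (0 < nat_of_word q')%N &
    qval p' q' = iter (size w) (fun y => (qval m n + y) / (1 + y)) (qval p q)].
Proof.
move=> emn; elim: w p q => [|b w ih] p q epq n0 p0 q0.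
  by exists p, q.
pose c := true :: p ++ m.
have mulc u v : (size u + size v = size p + size m)%N ->
    nat_of_word (mulk c u v [::]) = (nat_of_word u * nat_of_word v)%N.
  move=> e; apply: mulk_exact; rewrite /= size_cat -e expnS expnD.
  have := nat_of_word_lt u; have := nat_of_word_lt v; nia.
(* Each product is below [2 ^ (size p + size m)]; the extra letter of [c] makes room for the sum of
   two. *)
have addc u v u' v' : (size u + size v = size p + size m)%N ->
    (size u' + size v' = size p + size m)%N ->
    nat_of_word (addk c (mulk c u v [::]) (mulk c u' v' [::]) false) =
    (nat_of_word u * nat_of_word v + nat_of_word u' * nat_of_word v')%N.
  move=> e e'; rewrite addk_exact !mulc //= size_cat expnS -[in X in (_ < X)%N]e.
  have : (2 ^ (size u + size v) = 2 ^ (size u' + size v'))%N by rewrite e e'.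
  rewrite !expnD => E; rewrite mul2n -addnn {2}E.
  have := nat_of_word_lt u; have := nat_of_word_lt v.
  have := nat_of_word_lt u'; have := nat_of_word_lt v'.
  set a1 := nat_of_word u; set a2 := nat_of_word v.
  set a3 := nat_of_word u'; set a4 := nat_of_word v'.
  move=> h4 h3 h2 h1.
  have : (a1 * a2 < 2 ^ size u * 2 ^ size v)%N by exact: ltn_mul.
  have : (a3 * a4 < 2 ^ size u' * 2 ^ size v')%N by exact: ltn_mul.
  lia.
pose p1 := addk c (mulk c m q [::]) (mulk c n p [::]) false.
pose q1 := addk c (mulk c n p [::]) (mulk c n q [::]) false.
have ep1 : nat_of_word p1 =
    (nat_of_word m * nat_of_word q + nat_of_word n * nat_of_word p)%N.
  by rewrite addc //; lia.
have eq1 : nat_of_word q1 =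
    (nat_of_word n * nat_of_word p + nat_of_word n * nat_of_word q)%N.
  by rewrite addc //; lia.
have [||||p' [q' [h1 h2 h3 h4]]] := ih p1 q1.
- by rewrite !size_addk.
- by [].
- by rewrite ep1; nia.
- by rewrite eq1; nia.
exists p', q'; split=> //.
rewrite h4 iterSr; congr iter.
rewrite /qval ep1 eq1 !natrD !natrM.
have n0' : (0 : R) < (nat_of_word n)%:R by rewrite ltr0n.
have p0' : (0 : R) < (nat_of_word p)%:R by rewrite ltr0n.
have q0' : (0 : R) < (nat_of_word q)%:R by rewrite ltr0n.
have hpq : 0 < (nat_of_word p)%:R + (nat_of_word q)%:R :> R by rewrite addr_gt0.
field.
by rewrite !lt0r_neq0 // ?addr_gt0 ?mulr_gt0.
Qed.

Lemma pad_exact u v : nat_of_word (pad u v) = nat_of_word u.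
Proof.
rewrite /pad addk_exact ?addn0 // size_cat expnD.
have := nat_of_word_lt u; have : (0 < 2 ^ size v)%N by rewrite expn_gt0.
nia.
Qed.

Lemma sqrt_wordsE w o :
  [/\ (0 < nat_of_word (sqrt_num w o))%N, (0 < nat_of_word (sqrt_den w o))%N &
    qval (sqrt_num w o) (sqrt_den w o) = sqrt_iter (wval o) (size w)].
Proof.
have [|||||p' [q' [h1 h2 h3 h4]]] := @sqrt_stepE w (pad (numw o) (denw o))
  (pad (denw o) (numw o)) [:: true] [:: true].
- by rewrite !size_addk !size_cat addnC.
- by [].
- by rewrite pad_exact denw_gt0.
- by [].
- by [].
rewrite /sqrt_num /sqrt_den /sqrt_words h1; split=> //.
by rewrite h4 /sqrt_iter /wval /qval !pad_exact divr1.
Qed.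

Lemma factorE x y z b w :
  qval (factor_num x y z b w) (factor_den x y z b w) =
  wval x / ((wval y + wval z) * sqrt_iter (wval b) (size w)).
Proof.
have [hp hq <-] := sqrt_wordsE w b.
rewrite /factor_num /factor_den /wval /qval !mulwE addwE !mulwE.
have hx := denw_gt0 x; have hy := denw_gt0 y; have hz := denw_gt0 z.
rewrite !natrM natrD !natrM.
set X := (nat_of_word (numw x))%:R; set Y := (nat_of_word (numw y))%:R.
set Z := (nat_of_word (numw z))%:R; set P := (nat_of_word (sqrt_num _ _))%:R.
set X' : R := (nat_of_word (denw x))%:R; set Y' : R := (nat_of_word (denw y))%:R.
set Z' : R := (nat_of_word (denw z))%:R.
set Q : R := (nat_of_word (sqrt_den _ _))%:R.
have Y'0 : Y' != 0 by rewrite pnatr_eq0 -lt0n.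
have Z'0 : Z' != 0 by rewrite pnatr_eq0 -lt0n.
have -> : Y / Y' + Z / Z' = (Y * Z' + Z * Y') / (Y' * Z').
  by field; rewrite Y'0 Z'0.
(* The sum of the numerators may vanish; [invfM] and [invrK] are valid at 0 as well. *)
rewrite !invfM !invrK; ring.
Qed.

Lemma prod_stepE w P Q n0 d0 n1 d1
    (s := iter_word prod_step [:: w; P; Q; n0; d0; n1; d1]) :
  qval (nth [::] s 0) (nth [::] s 1) =
  qval P Q * \prod_(b <- w) (if b then qval n1 d1 else qval n0 d0).
Proof.
rewrite {}/s /iter_word /=; elim: w P Q => [|b w ih] P Q /=.
  by rewrite big_nil mulr1.
rewrite ih big_cons mulrA; congr (_ * _).
by rewrite /qval !mulwE !natrM invfM; case: b => /=; ring.
Qed.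

Lemma output_wordE w o x y z b0 b1 k :
  ratr (rat_of_word (output_word w o x y z b0 b1 k)) =
  wval o * \prod_(b <- w) (wval x /
    ((wval y + wval z) * sqrt_iter (wval (if b then b1 else b0)) (size k))).
Proof.
rewrite ratr_fraction_word prod_stepE; congr (_ * _).
by apply: eq_bigr => -[] _; rewrite factorE.
Qed.

End Values.

(** * Geometric convergence *)

Section GeometricConvergence.
Variable R : realType.
Implicit Types (u v : nat -> R) (x y C rho : R).

Lemma expr_small rho x : 0 <= rho < 1 -> 0 < x -> exists K : nat,
  (0 < K)%N /\ rho ^+ K <= x.
Proof.
move=> /andP[r0 r1] x0.
have /cvgrPdist_lt/(_ x x0) [K _ hK] : rho ^+ n @[n --> \oo] --> (0 : R).
  by apply: cvg_expr; rewrite ger0_norm.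
exists K.+1; split=> //; have := hK K.+1 (leqnSn K).
by rewrite sub0r normrN ger0_norm ?exprn_ge0 // => /ltW.
Qed.

Lemma ler_mul_expr C C' rho rho' k : 0 <= C -> C <= C' -> 0 <= rho ->
  rho <= rho' -> C * rho ^+ k <= C' * rho' ^+ k.
Proof.
move=> C0 CC' r0 rr'; rewrite ler_pM ?exprn_ge0 // lerXn2r // nnegrE.
exact: le_trans rr'.
Qed.

(** [2^-1 <= rho] lets the errors [2 ^- k] of computed values be absorbed into [rho ^+ k], and
    [1 <= C] keeps later constants at least 1. The threshold [k0] is there for inverses, which need
    the sequence to stay away from 0. *)
Definition gconv u x := exists C rho k0,
  [/\ 1 <= C, 2^-1 <= rho < 1 & forall k, (k0 <= k)%N -> `|u k - x| <= C * rho ^+ k].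

Lemma gconv_common u v x y : gconv u x -> gconv v y -> exists C rho k0,
  [/\ 1 <= C, 2^-1 <= rho < 1,
     forall k, (k0 <= k)%N -> `|u k - x| <= C * rho ^+ k &
     forall k, (k0 <= k)%N -> `|v k - y| <= C * rho ^+ k].
Proof.
move=> [C [r [k0 [hC /andP[r0 r1] hu]]]] [C' [r' [k0' [hC' /andP[r0' r1'] hv]]]].
exists (Num.max C C'), (Num.max r r'), (maxn k0 k0'); split.
- by rewrite le_max hC.
- by rewrite le_max r0 /= gt_max r1.
- move=> k; rewrite geq_max => /andP[hk _]; apply: le_trans (hu _ hk) _.
  by apply: ler_mul_expr; rewrite ?le_max ?lexx //; lra.
- move=> k; rewrite geq_max => /andP[_ hk]; apply: le_trans (hv _ hk) _.
  by apply: ler_mul_expr; rewrite ?le_max ?lexx ?orbT //; lra.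
Qed.

Lemma gconvI u x C rho k0 : 0 <= rho < 1 ->
  (forall k, (k0 <= k)%N -> `|u k - x| <= C * rho ^+ k) -> gconv u x.
Proof.
move=> /andP[r0 r1] hu; exists (Num.max 1 C), (Num.max 2^-1 rho), k0; split.
- by rewrite le_max lexx.
- by rewrite le_max lexx /= gt_max r1 andbT; lra.
move=> k /hu le; apply: le_trans le _.
have [C0|C0] := leP 0 C.
  by apply: ler_mul_expr; rewrite ?le_max ?lexx ?orbT.
apply: (@le_trans _ _ 0); first by rewrite mulr_le0_ge0 ?exprn_ge0 // ltW.
by rewrite mulr_ge0 ?exprn_ge0 // le_max ?ler01 ?r0 ?orbT.
Qed.

Lemma gconv_pow2 u x : (forall k, `|u k - x| <= 2 ^- k) -> gconv u x.
Proof.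
move=> h; apply: (@gconvI u x 1 2^-1 0); first lra.
by move=> k _; rewrite mul1r exprVn.
Qed.

Lemma rho_expr_le1 rho k : 2^-1 <= rho < 1 -> 0 <= rho ^+ k <= 1.
Proof.
move=> /andP[h1 h2]; have r0 : 0 <= rho by lra.
by rewrite exprn_ge0 //= exprn_ile1 // ltW.
Qed.

Lemma gconvD u v x y : gconv u x -> gconv v y -> gconv (fun k => u k + v k) (x + y).
Proof.
move=> hu hv; have [C [r [k0 [hC hr h1 h2]]]] := gconv_common hu hv.
apply: (@gconvI _ _ (2 * C) r k0); first lra.
move=> k hk; have -> : u k + v k - (x + y) = (u k - x) + (v k - y) by ring.
apply: le_trans (ler_normD _ _) _.
by rewrite -mulrA mulr_natl mulr2n lerD ?h1 ?h2.
Qed.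

Lemma gconvM u v x y : gconv u x -> gconv v y -> gconv (fun k => u k * v k) (x * y).
Proof.
move=> hu hv; have [C [r [k0 [hC hr h1 h2]]]] := gconv_common hu hv.
apply: (@gconvI _ _ ((`|y| + C + `|x|) * C) r k0); first lra.
move=> k hk; have -> : u k * v k - x * y = (u k - x) * v k + x * (v k - y) by ring.
apply: le_trans (ler_normD _ _) _; rewrite !normrM.
have e1 := h1 k hk; have e2 := h2 k hk; have /andP[r0' r1'] := rho_expr_le1 k hr.
have hv' : `|v k| <= `|y| + C.
  have -> : v k = y + (v k - y) by ring.
  apply: le_trans (ler_normD _ _) _; rewrite lerD2l; apply: le_trans e2 _.
  by rewrite ler_piMr //; lra.
rewrite -mulrA mulrDl lerD // ?ler_wpM2l //.
by rewrite [leRHS]mulrC ler_pM.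
Qed.

Lemma gconvV u x : 0 < x -> gconv u x -> gconv (fun k => (u k)^-1) x^-1.
Proof.
move=> x0 [C [r [k0 [hC hr h1]]]].
(* Past [k0] and [K] the error is at most [x / 2], which keeps [u k] at least [x / 2]. *)
have [K [K0 hK]] : exists K : nat, (0 < K)%N /\ r ^+ K <= x / (2 * C).
  by apply: expr_small; [lra | rewrite divr_gt0 // mulr_gt0 //; lra].
apply: (@gconvI _ _ (2 / x ^+ 2 * C) r (maxn k0 K)); first lra.
move=> k; rewrite geq_max => /andP[/h1 e hk].
have hrk : C * r ^+ k <= x / 2.
  have -> : x / 2 = C * (x / (2 * C)) by field; lra.
  rewrite ler_wpM2l //; first lra; apply: le_trans hK.
  by rewrite ler_wiXn2l //; lra.
have hu : x / 2 <= u k by move: e; rewrite ler_distl => /andP[+ _]; lra.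
have u0 : 0 < u k by lra.
have -> : (u k)^-1 - x^-1 = (x - u k) / (u k * x) by field; lra.
rewrite normrM normfV distrC [`|u k * x|]gtr0_norm ?mulr_gt0 //.
have -> : 2 / x ^+ 2 * C * r ^+ k = (C * r ^+ k) * (2 / x ^+ 2) by ring.
rewrite ler_pM // ?invr_ge0 ?mulr_ge0 //; try lra.
have -> : 2 / x ^+ 2 = (x / 2 * x)^-1 by field; lra.
by rewrite lef_pV2 ?posrE ?mulr_gt0 // ?ler_wpM2r //; lra.
Qed.

(* The fixed point [s] of [y |-> (a + y) / (1 + y)] is a square root of [a],
   and the iteration contracts towards it with ratio [1 - s]. *)
Lemma sqrt_iter_dist (a b s : R) k : 0 <= a -> 0 < s < 1 -> s ^+ 2 = b ->
  0 <= sqrt_iter a k /\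
  `|sqrt_iter a k - s| <= (1 - s) ^+ k + `|a - b| / s.
Proof.
move=> a0 /andP[s0 s1] hs; elim: k => [|k [y0 ih]].
  rewrite /sqrt_iter /= expr0; split=> //.
  have : 0 <= `|a - b| / s by rewrite divr_ge0 // ltW.
  by rewrite [`|1 - s|]ger0_norm; lra.
rewrite /sqrt_iter iterS -/(sqrt_iter a k); set y := sqrt_iter a k in y0 ih *.
split; first by rewrite divr_ge0 // addr_ge0.
(* This is where [b = s ^+ 2] enters. As [1 + y >= 1], a step multiplies the error by at most
   [1 - s] and adds at most [|a - b|]; the geometric series of these additions sums to
   [|a - b| / s]. *)
have -> : (a + y) / (1 + y) - s = ((a - b) + (1 - s) * (y - s)) / (1 + y).
  by rewrite -hs; field; lra.
rewrite normrM normfV [`|1 + y|]ger0_norm; last lra.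
rewrite ler_pdivrMr; last lra.
apply: (@le_trans _ _ (`|a - b| + (1 - s) * `|y - s|)).
  apply: le_trans (ler_normD _ _) _; rewrite normrM lerD2l.
  by rewrite [`|1 - s|]ger0_norm //; lra.
have h1 : (1 - s) * `|y - s| <= (1 - s) * ((1 - s) ^+ k + `|a - b| / s).
  by rewrite ler_wpM2l //; lra.
have h2 : `|a - b| + (1 - s) * ((1 - s) ^+ k + `|a - b| / s) =
    (1 - s) ^+ k.+1 + `|a - b| / s by rewrite exprS; field; lra.
have h3 : 0 <= (1 - s) ^+ k.+1 + `|a - b| / s.
  by rewrite addr_ge0 ?exprn_ge0 ?divr_ge0 //; lra.
have h4 : (1 - s) ^+ k.+1 + `|a - b| / s <=
   ((1 - s) ^+ k.+1 + `|a - b| / s) * (1 + y) by rewrite ler_peMr //; lra.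
lra.
Qed.

(** The number of iterations and the precision of the radicand grow together: both [(1 - s) ^+ k]
    and the propagated error of [u k] are geometric. *)
Lemma gconv_sqrt u b s : (forall k, 0 <= u k) -> 0 < s < 1 -> s ^+ 2 = b ->
  gconv u b -> gconv (fun k => sqrt_iter (u k) k) s.
Proof.
move=> u0 hs hb [C [r [k0 [hC hr h1]]]].
apply: (@gconvI _ _ (1 + C / s) (Num.max r (1 - s)) k0).
  by rewrite le_max gt_max; lra.
move=> k hk; have [_ h] := sqrt_iter_dist k (u0 k) hs hb.
apply: le_trans h _.
have m0 : 0 <= Num.max r (1 - s) by rewrite le_max; lra.
have e1 : (1 - s) ^+ k <= Num.max r (1 - s) ^+ k.
  by rewrite lerXn2r ?nnegrE // ?le_max ?lexx ?orbT //; lra.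
have e2 : `|u k - b| / s <= C * Num.max r (1 - s) ^+ k / s.
  rewrite ler_wpM2r ?invr_ge0 //; first lra.
  apply: le_trans (h1 k hk) _; rewrite ler_wpM2l //; first lra.
  by rewrite lerXn2r ?nnegrE // ?le_max ?lexx //; lra.
have -> : (1 + C / s) * Num.max r (1 - s) ^+ k =
  Num.max r (1 - s) ^+ k + C * Num.max r (1 - s) ^+ k / s by field; lra.
exact: lerD.
Qed.

End GeometricConvergence.

(** * Error of the product *)

Section ProductError.
Variable R : realType.

Lemma norm_prod_le (v : bool -> R) (B : R) (w : word) :
  (forall b, `|v b| <= B) -> `|\prod_(b <- w) v b| <= B ^+ size w.
Proof.
move=> hv; elim: w => [|b w ih]; first by rewrite big_nil normr1 expr0.
by rewrite big_cons normrM exprS ler_pM.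
Qed.

(** Factors are exchanged one at a time: there are [size w] exchanges, each with error at most [e]
    times the other factors, whose product is at most [B ^+ size w]. *)
Lemma prod_dist (u f : bool -> R) (B e : R) (w : word) : 1 <= B ->
  (forall b, `|u b| <= B) -> (forall b, `|f b| <= B) ->
  (forall b, `|u b - f b| <= e) ->
  `|\prod_(b <- w) u b| <= B ^+ size w /\
  `|\prod_(b <- w) u b - \prod_(b <- w) f b| <= (size w)%:R * B ^+ size w * e.
Proof.
move=> B1 hu hf he; have e0 : 0 <= e by apply: le_trans (he true).
have B0 : 0 <= B by lra.
split; first exact: norm_prod_le.
elim: w => [|b w ih]; first by rewrite !big_nil subrr normr0 !mul0r.
rewrite !big_cons.
set U := \prod_(j <- w) u j; set F := \prod_(j <- w) f j.
have -> : u b * U - f b * F = u b * (U - F) + (u b - f b) * F by ring.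
apply: le_trans (ler_normD _ _) _; rewrite !normrM.
have hF : `|F| <= B ^+ size w by exact: norm_prod_le.
have Bn : 0 <= B ^+ size w by rewrite exprn_ge0.
have h1 : `|u b| * `|U - F| <= B * ((size w)%:R * B ^+ size w * e).
  by rewrite ler_pM.
have h2 : `|u b - f b| * `|F| <= e * B ^+ size w by rewrite ler_pM.
have h3 : e * B ^+ size w <= e * B ^+ (size w).+1.
  by rewrite ler_wpM2l // exprS ler_peMl.
apply: le_trans (lerD h1 (le_trans h2 h3)) _.
rewrite [size (b :: w)]/= -[(size w).+1%:R]natr1 exprS; lra.
Qed.

Lemma exprM_cancel (x : R) m r : 0 < x ->
  x ^+ m * (2 * x) ^- (m + r) = 2 ^- m * (2 * x) ^- r.
Proof.
move=> x0; rewrite exprD invfM mulrA; congr (_ * _).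
by rewrite exprMn invfM mulrC -mulrA mulVf ?mulr1 // expf_neq0 // gt_eqF.
Qed.

(** With [n = size w] and the constants of the proof, the error is at most
    [n.+1 * H ^+ n.+1 * rho ^+ k], hence at most [G ^+ n.+1 * rho ^+ k] for [G = 2 * H]. Precision
    proportional to [n + r + 1] brings [rho ^+ k] below [(2 * G) ^- (n.+1 + r)], which leaves at
    most [2 ^- r]. *)
Lemma prod_gale_dist (dh : word -> nat -> R) (d : word -> R)
    (u : bool -> nat -> R) (f : bool -> R) (A : R) :
  (forall w k, `|dh w k - d w| <= 2 ^- k) -> 1 <= A ->
  (forall w, `|d w| <= A ^+ (size w).+1) -> (forall b, gconv (u b) (f b)) ->
  exists K : nat, forall w r, let k := (K * (size w + r + 1))%N in
    `|dh w k * \prod_(b <- w) u b k - d w * \prod_(b <- w) f b| <= 2 ^- r.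
Proof.
move=> hd A1 hA hu.
have [C [rho [k0 [C1 hr h1 h0]]]] := gconv_common (hu true) (hu false).
pose B := `|f true| + `|f false| + C.
have := normr_ge0 (f true); have := normr_ge0 (f false) => f0 f1.
have B1 : 1 <= B by rewrite /B; lra.
have hf b : `|f b| <= B.
  by rewrite /B; case: b; lra.
pose H := A * B * C; pose G := 2 * H.
have H1 : 1 <= H by rewrite /H !mulr_ege1.
have [K1 [_ hK1]] : exists K : nat, (0 < K)%N /\ rho ^+ K <= (2 * G)^-1.
  by apply: expr_small; [lra | rewrite invr_gt0 /G; lra].
have r0 : 0 <= rho by lra.
(* [k0 < K] puts [k] past the threshold even for empty [w] and [r = 0]. *)
have [K lt_k0 le_K1] : exists2 K, (k0 < K)%N & (K1 <= K)%N.
  by exists (K1 + k0).+1; lia.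
exists K => w r; set n := size w; cbv zeta.
have [k ek] : exists k, k = (K * (n + r + 1))%N by eexists.
rewrite -ek.
have hk0 : (k0 <= k)%N by rewrite ek; nia.
have /andP[p0 p1] := rho_expr_le1 k hr.
have he b : `|u b k - f b| <= C * rho ^+ k by case: b; [exact: h1 | exact: h0].
have huB b : `|u b k| <= B.
  have -> : u b k = f b + (u b k - f b) by ring.
  apply: le_trans (ler_normD _ _) _.
  have h2 : C * rho ^+ k <= C by rewrite ler_piMr //; lra.
  have h3 := he b.
  by rewrite /B; case: b h3; lra.
have [hU hUF] := prod_dist w B1 huB hf he.
set U := \prod_(b <- w) u b k in hU hUF *; set F := \prod_(b <- w) f b in hUF *.
have -> : dh w k * U - d w * F = (dh w k - d w) * U + d w * (U - F) by ring.
apply: le_trans (ler_normD _ _) _; rewrite !normrM -/n.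
have h2 : `|dh w k - d w| <= rho ^+ k.
  apply: le_trans (hd w k) _; rewrite -exprVn lerXn2r ?nnegrE //; lra.
have A0 : 0 <= A by lra.
have B0 : 0 <= B by lra.
have C0 : 0 <= C by lra.
have H0 : 0 <= H by lra.
have hH : B ^+ n <= H ^+ n.+1.
  apply: (@le_trans _ _ (B ^+ n.+1)); first by rewrite exprS ler_peMl ?exprn_ge0.
  rewrite lerXn2r ?nnegrE // /H mulrAC ler_peMl // mulr_ege1 //.
have hH2 : A ^+ n.+1 * B ^+ n * C <= H ^+ n.+1.
  rewrite /H !exprMn -!mulrA ler_wpM2l ?exprn_ge0 // ler_pM ?exprn_ge0 //.
    by rewrite exprS ler_peMl ?exprn_ge0.
  by rewrite exprS ler_peMr // exprn_ege1.
have t1 : `|dh w k - d w| * `|U| <= rho ^+ k * H ^+ n.+1.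
  by rewrite ler_pM //; exact: le_trans hH.
have t2 : `|d w| * `|U - F| <= n%:R * H ^+ n.+1 * rho ^+ k.
  apply: (@le_trans _ _ (A ^+ n.+1 * (n%:R * B ^+ n * (C * rho ^+ k)))).
    by rewrite ler_pM.
  have -> : A ^+ n.+1 * (n%:R * B ^+ n * (C * rho ^+ k)) =
    n%:R * (A ^+ n.+1 * B ^+ n * C) * rho ^+ k by ring.
  by rewrite ler_wpM2r // ler_wpM2l.
have G1 : 1 <= G by rewrite /G; lra.
have t3 : rho ^+ k * H ^+ n.+1 + n%:R * H ^+ n.+1 * rho ^+ k <=
    G ^+ n.+1 * rho ^+ k.
  have -> : rho ^+ k * H ^+ n.+1 + n%:R * H ^+ n.+1 * rho ^+ k =
    n.+1%:R * H ^+ n.+1 * rho ^+ k by rewrite -natr1; ring.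
  rewrite ler_wpM2r // /G [(2 * H) ^+ _]exprMn ler_wpM2r ?exprn_ge0 //.
  by rewrite -natrX ler_nat ltnW // ltn_expl.
apply: le_trans (lerD t1 t2) (le_trans t3 _).
have hK : rho ^+ K <= (2 * G)^-1.
  apply: le_trans hK1; apply: ler_wiXn2l => //; lra.
have t4 : rho ^+ k <= (2 * G) ^- (n.+1 + r).
  have -> : k = (K * (n.+1 + r))%N by rewrite ek addnAC addn1.
  rewrite exprM -exprVn; apply: lerXn2r => //; rewrite nnegrE ?exprn_ge0 //.
  by rewrite invr_ge0; lra.
apply: (@le_trans _ _ (G ^+ n.+1 * (2 * G) ^- (n.+1 + r))).
  by rewrite ler_wpM2l // exprn_ge0 //; lra.
have G0 : 0 < G by lra.
have -> : G ^+ n.+1 * (2 * G) ^- (n.+1 + r) = 2 ^- n.+1 * (2 * G) ^- r.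
  exact: exprM_cancel.
have t5 : (2 * G) ^- r <= 2 ^- r.
  by rewrite lef_pV2 ?posrE ?exprn_gt0 ?lerXn2r ?nnegrE //; lra.
apply: le_trans t5; rewrite ler_piMl ?invr_ge0 ?exprn_ge0 //; first lra.
by rewrite invf_le1 ?exprn_gt0 // exprn_ege1 //; lra.
Qed.

End ProductError.

(** * Conversion of the gale *)

Section Conversion.
Variables (R : realType) (g : word -> word).

Lemma succeeds_le (d d' : word -> R) A : (forall w, d w <= d' w) ->
  succeeds d A -> succeeds d' A.
Proof.
rewrite /succeeds /limn_esup => le h; apply/eqP; rewrite -leye_eq -h.
apply: le_ereal_inf_tmp => _ [V FV <-]; apply: ge_ereal_inf.
exists (ereal_sup ((fun n => (d (char_prefix A n))%:E) @` V)); first by exists V.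
apply: ge_ereal_sup => _ [n Vn <-]; apply: le_ereal_sup_tmp.
exists (d' (char_prefix A n))%:E; first by exists n.
by rewrite lee_fin.
Qed.

(** Both summands of the gale equation are nonnegative and the weights are positive, so the value 0
    is inherited by extensions. *)
Lemma gale_eq0 (beta : bool -> R) s d : (forall b, 0 < beta b) ->
  gale beta s d -> d [::] = 0 -> forall w, d w = 0.
Proof.
move=> hb [d0 dE] dn; elim/last_ind => // w b ih.
have h1 : 0 <= d (rcons w false) * beta false `^ s by rewrite mulr_ge0 ?powR_ge0.
have h2 : 0 <= d (rcons w true) * beta true `^ s by rewrite mulr_ge0 ?powR_ge0.
have h3 := dE w; rewrite ih in h3.
have h4 : d (rcons w b) * beta b `^ s = 0 by case: b; lra.
apply/eqP; move/eqP: h4; rewrite mulf_eq0 => /orP[//|].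
by rewrite gt_eqF // powR_gt0.
Qed.

(** The weight [beta b] to the power 1/2 cancels the denominator of the new factor and leaves [c],
    the weight in the uniform gale. *)
Lemma half_gale_conversion (beta : bool -> R) s d c :
  (forall b, 0 < beta b) -> c = 2^-1 `^ s -> gale (@uniform R) s d ->
  gale beta 2^-1
    (fun w => d w * \prod_(b <- w) (c / Num.sqrt (beta b))).
Proof.
move=> hb hc [d0 dE]; have c0 : 0 < c by rewrite hc powR_gt0.
split=> w.
  by rewrite mulr_ge0 // prodr_ge0 // => b _; rewrite divr_ge0 ?sqrtr_ge0 // ltW.
rewrite (dE w) /uniform -hc -!cats1 !big_cat /= !big_seq1 !powR12_sqrt ?ltW //.
have sf : Num.sqrt (beta false) != 0 by rewrite gt_eqF // sqrtr_gt0.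
have st : Num.sqrt (beta true) != 0 by rewrite gt_eqF // sqrtr_gt0.
by field; rewrite sf st.
Qed.

Lemma pg_computable_conversion (beta : bool -> R) s d c :
  (forall b, 0 < beta b) -> (forall b, beta b < 1) ->
  (forall b, pg_computable_real g (beta b)) ->
  c = 2^-1 `^ s -> gale (@uniform R) s d -> pg_computable g d -> 0 < d [::] ->
  pg_computable g (fun w => d w * \prod_(b <- w) (c / Num.sqrt (beta b))).
Proof.
move=> hb hb1 hbc hc [d0 dE] [fd [pd hfd]] dn.
have [fF [pF hF]] := hbc false; have [fT [pT hT]] := hbc true.
have c0 : 0 < c by rewrite hc powR_gt0.
have {}dE w : d w = (d (rcons w false) + d (rcons w true)) * c.
  by rewrite dE /uniform -hc mulrDl.
pose val (f : 2.-tuple word -> word) w k : R := wval R (f [tuple w; nseq k true]).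
pose fb b := if b then fT else fF.
have hdv w k : `|val fd w k - d w| <= 2 ^- k.
  exact: le_trans (wval_dist _ (d0 w)) (hfd w k).
have hbv b k : `|val (fb b) [::] k - beta b| <= 2 ^- k.
  by case: b; apply: le_trans (wval_dist _ (ltW (hb _))) _; [exact: hT | exact: hF].
pose u b k := val fd [::] k /
  ((val fd [:: false] k + val fd [:: true] k) * sqrt_iter (val (fb b) [::] k) k).
(* Strictly below 1, so that the square root iteration contracts with a ratio in the open unit
   interval. *)
have hs b : 0 < Num.sqrt (beta b) < 1.
  rewrite sqrtr_gt0 hb /= -[ltRHS]sqrtr1 ltr_sqrt //.
have hu b : gconv (u b) (c / Num.sqrt (beta b)).
  have S0 : 0 < d [:: false] + d [:: true].
    by have := dE [::]; rewrite /= => h; rewrite -(pmulr_lgt0 _ c0) -h.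
  have -> : c / Num.sqrt (beta b) =
      d [::] * ((d [:: false] + d [:: true]) * Num.sqrt (beta b))^-1.
    have := dE [::]; rewrite /= => ->.
    have /andP[s0 _] := hs b.
    by field; rewrite !gt_eqF.
  apply: gconvM; first exact/gconv_pow2/hdv.
  apply: gconvV; first by have /andP[s0 _] := hs b; rewrite mulr_gt0.
  apply: gconvM; first by apply: gconvD; exact/gconv_pow2/hdv.
  apply: (gconv_sqrt (b := beta b)) => //.
  - by move=> k; exact: qval_ge0.
  - by rewrite sqr_sqrtr // ltW.
  exact/gconv_pow2/hbv.
(* By the gale equation one more letter multiplies [d] by at most [c^-1]; [A] dominates both this
   ratio and the initial value. *)
pose A := 1 + d [::] + c^-1.
have ci0 : 0 < c^-1 by rewrite invr_gt0.
have A1 : 1 <= A by rewrite /A; lra.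
have hA w : `|d w| <= A ^+ (size w).+1.
  rewrite ger0_norm //; elim/last_ind: w => [|w b ih].
    by rewrite expr1 /A; lra.
  have : d (rcons w b) <= d w * c^-1.
    rewrite ler_pdivlMr // [leRHS]dE ler_wpM2r // ?(ltW c0) //.
    by case: b; rewrite ?lerDl ?lerDr.
  move/le_trans; apply; rewrite size_rcons exprSr.
  by rewrite ler_pM // ?(ltW ci0) // /A; lra.
have [K hK] := prod_gale_dist hdv A1 hA hu.
exists (fun xs : 2.-tuple word =>
  pipeline K fd fF fT (nth [::] xs 0) (nth [::] xs 1)); split.
  exact: in_pg_pipeline.
move=> w r; rewrite /pipeline /precision /= output_wordE !size_nseq.
set k := (K * _)%N; have := hK w r; rewrite -/k.
congr (`|_ * _ - _| <= _); apply: eq_bigr => b _.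
by rewrite /u /val /fb; case: b.
Qed.

End Conversion.

Local Open Scope ereal_scope.

Theorem theorem6p3 (R : realType) (beta : bool -> R) (X : set language)
    (g : word -> word)
    (beta_pos : positive_distribution beta)
    (beta_comp : forall b : bool, pg_computable_real g (beta b)) :
  dim_pg R g X = 0 -> dim_pg_beta g beta X < 1.
Proof.
case: beta_pos => hb hsum dim0.
have hb1 b : (beta b < 1)%R by have := hb true; have := hb false; case: b; lra.
(* As [ln 2^-1 < 0], the condition [s <= eps b] says exactly that 2^-s is at least the square root
   of [beta b]. *)
pose eps b : R := (ln (beta b) / (2 * ln 2^-1))%R.
have ln_half : (ln 2^-1 < 0 :> R)%R by apply: ln_lt0; lra.
have eps_gt0 b : (0 < eps b)%R.
  by rewrite /eps nmulr_rgt0 ?ln_lt0 ?hb ?hb1 // invr_lt0; lra.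
have : dim_pg R g X < (Num.min (eps false) (eps true))%:E.
  by rewrite dim0 lte_fin lt_min !eps_gt0.
case/ereal_inf_lt => _ [s [s0 [d [dgale dcomp dsucc]]] <-].
rewrite lte_fin lt_min => /andP[hs0 hs1].
have hs b : (s < eps b)%R by case: b.
suff : exists d' : word -> R, [/\ gale beta 2^-1 d', pg_computable g d' &
    forall A, X A -> succeeds d' A].
  move=> hd'; apply: (@le_lt_trans _ _ (2^-1)%:E); last by rewrite lte_fin; lra.
  by apply: ereal_inf_lbound; exists 2^-1%R => //; split.
(* A gale that starts with 0 is the zero function, which solves the gale equation for all weights;
   success is inherited because the function is unchanged. *)
have [dn|dn] := eqVneq (d [::]) 0%R.
  have dw : forall w, d w = 0%R.
    by apply: gale_eq0 dgale dn => b; rewrite /uniform; lra.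
  exists d; split=> //; split=> w; rewrite ?dw //.
  by rewrite !mul0r addr0.
have dn0 : (0 < d [::])%R by rewrite lt_neqAle eq_sym dn (dgale.1 [::]).
pose c : R := (2^-1 `^ s)%R.
exists (fun w => d w * \prod_(b <- w) (c / Num.sqrt (beta b)))%R; split.
- exact: half_gale_conversion.
- exact: (pg_computable_conversion hb hb1 beta_comp erefl dgale).
move=> A /dsucc; apply: succeeds_le => w.
rewrite ler_peMr ?(dgale.1 w) //.
elim: w => [|b w ih]; first by rewrite big_nil.
rewrite big_cons mulr_ege1 //.
rewrite ler_pdivlMr ?sqrtr_gt0 // mul1r -powR12_sqrt ?(ltW (hb b)) //.
(* Both powers become exponentials; comparing exponents amounts to [s < eps b] multiplied by the
   negative number [2 * ln 2^-1]. *)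
rewrite /c /powR (gt_eqF (hb b)) gt_eqF ?invr_gt0 //= ler_expR.
have := hs b; rewrite /eps ltr_ndivlMr; last lra.
by lra.
Qed.
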